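(* Let $\sigma\subset N_{\mathbb R}$ be a strongly convex rational polyhedral cone of dimension $n$ in $N_{\mathbb R}\cong\mathbb R^n$, and let $\Sigma_Y$ be a barycentric subdivision of $\sigma$. Then the associated simplicial polytopal complex $\mathcal C_Y$ (the cone over which is $\Sigma_Y$) is shellable.
   Context: $N$ is a free abelian group of rank $n$, $M=\mathrm{Hom}(N,\mathbb Z)$, and subscripts $\mathbb Q,\mathbb R$ denote tensoring with $\mathbb Q,\mathbb R$. Barycentric subdivision. Choose $l\in M_{\mathbb Q}$ with $l\ge0$ on $\sigma$ and $\{l=0\}\cap\sigma=\{0\}$, and let $P=\sigma\cap\{l=1\}$, a polytope. For each nonzero face $\mu$ of $\sigma$ choose $\rho_\mu\in N_{\mathbb Q}\cap P$ in the relative interior of $\mu$. The barycentric subdivision $\Sigma_Y$ of $\sigma$ (with respect to these choices) is the fan whose maximal cones are $\mathrm{span}_{\mathbb R_{\ge0}}\{\rho_{\mu_1},\dots,\rho_{\mu_n}\}$, for all chains of faces $\mu_1\subset\mu_2\subset\dots\subset\mu_n=\sigma$ with $\dim\mu_i=i$. The complex $\mathcal C_Y$ consists of the slices by $\{l=1\}$ of the cones of $\Sigma_Y$: its maximal simplices are the convex hulls of $\{\rho_{\mu_1},\dots,\rho_{\mu_n}\}$ for such chains, and its other elements are the faces of these. (So $\mathcal C_Y$ is a subdivision of $P$.) Polytopal complexes. A polytopal complex is a finite nonempty collection $\mathcal C$ of polytopes (its faces) in some $\mathbb R^m$ that contains all faces of its members and such that the intersection of any two members is a face of each. Its facets are its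 inclusion-maximal faces; it is pure if all facets have the same dimension, and simplicial if all faces are simplices. For a polytope $F$, $\mathcal C(\partial F)$ denotes the complex of all proper faces of $F$. Shelling. Let $\mathcal C$ be a pure polytopal complex. A shelling of $\mathcal C$ is a linear ordering $F_1,\dots,F_s$ of its facets such that either $\mathcal C$ is a set of points ($0$-dimensional), or: (1) $\mathcal C(\partial F_1)$ has a shelling; and (2) for each $1<j\le s$ one has $F_j\cap\big(\bigcup_{i=1}^{j-1}F_i\big)=G_1\cup\dots\cup G_r$ with $r\ge1$, for some shelling $G_1,\dots,G_r,\dots,G_t$ of $\mathcal C(\partial F_j)$. A pure polytopal complex is shellable if it has a shelling. *)

(* Defs.v *)
From mathcomp Require Import all_boot all_order all_algebra.
From mathcomp Require Import all_classical all_reals all_analysis.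
Set Implicit Arguments.
Unset Strict Implicit.
Unset Printing Implicit Defensive.
Import Order.TTheory GRing.Theory Num.Theory.
Import numFieldNormedType.Exports.
Local Open Scope classical_set_scope.
Local Open Scope ring_scope.

(* Coordinates: N = 'rV[int]_n, N_Q = 'rV[rat]_n, N_R = 'rV[R]_n, and dually
   M_Q = 'cV[rat]_n, M_R = 'cV[R]_n. *)

Section Hulls.
Variables (R : realType) (m : nat).
Local Notation E := 'rV[R]_m.

Definition pairing (f : 'cV[R]_m) (x : E) : R := (x *m f) 0 0.

Definition cone_hull (A : set E) : set E :=
  [set x | exists (k : nat) (a : 'I_k -> E) (t : 'I_k -> R),
     [/\ forall i, A (a i), forall i, 0 <= t i & x = \sum_i t i *: a i]].

Definition aff_hull (A : set E) : set E :=
  [set x | exists (k : nat) (a : 'I_k -> E) (t : 'I_k -> R),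
     [/\ forall i, A (a i), \sum_i t i = 1 & x = \sum_i t i *: a i]].

Definition conv_hull (A : set E) : set E :=
  [set x | exists (k : nat) (a : 'I_k -> E) (t : 'I_k -> R),
     [/\ forall i, A (a i), forall i, 0 <= t i,
         \sum_i t i = 1 & x = \sum_i t i *: a i]].

Definition lin_span (A : set E) : {vspace E} :=
  xget fullv [set U : {vspace E} |
    forall W : {vspace E}, A `<=` [set` W] <-> (U <= W)%VS].

Lemma lin_spanP (A : set E) (W : {vspace E}) :
  A `<=` [set` W] <-> (lin_span A <= W)%VS.
Proof.
suff exU : exists U, [set U : {vspace E} |
    forall W : {vspace E}, A `<=` [set` W] <-> (U <= W)%VS] U.
  exact: (xgetPex fullv exU W).
pose P k := `[< exists s : seq E,
  [/\ size s = k, free s & forall x, x \in s -> A x] >].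
have exP : exists k, P k.
  by exists 0%N; apply/asboolP; exists [::]; split=> //; exact: nil_free.
have ubP k : P k -> (k <= \dim {:E})%N.
  move=> /asboolP[s [<- sfree _]].
  by rewrite -(eqP sfree); apply: dimvS; apply: subvf.
case: (ex_maxnP exP ubP) => k /asboolP[s [sk sfree sA]] kmax.
exists (span s) => V; split=> [AV|sV x Ax].
  by apply/span_subvP => x /sA /AV.
apply: (subvP sV); apply: contraPT isT => xs.
have /kmax : P k.+1.
  apply/asboolP; exists (x :: s); split; rewrite /= ?sk ?free_cons ?xs //.
  by move=> y; rewrite inE => /predU1P[->|/sA].
by rewrite ltnn.
Qed.

(* Dimension of a cone. *)
Definition lin_dim (A : set E) : nat := \dim (lin_span A).

(* Dimension of a nonempty convex set; for the empty set this is 0, not -1. *)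
Definition aff_dim (A : set E) : nat :=
  \dim (lin_span [set v | exists x y, [/\ A x, A y & v = x - y]]).

Definition relint (A : set E) : set E :=
  (A : set (subspace (aff_hull A)))°.

Definition strongly_convex (sigma : set E) : Prop :=
  forall x, sigma x -> sigma (- x) -> x = 0.

Definition cone_face (sigma tau : set E) : Prop :=
  exists f : 'cV[R]_m, (forall x, sigma x -> 0 <= pairing f x) /\
    tau = sigma `&` [set x | pairing f x = 0].

Definition polytope (F : set E) : Prop :=
  exists2 A, finite_set A & F = conv_hull A.

(* The empty set and P itself are faces of P: take f = 0 and c = 1 or 0. *)
Definition polytope_face (P F : set E) : Prop :=
  exists (f : 'cV[R]_m) (c : R), (forall x, P x -> pairing f x <= c) /\
    F = P `&` [set x | pairing f x = c].

Definition aff_indep (k : nat) (p : 'I_k -> E) : Prop :=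
  forall t : 'I_k -> R, \sum_i t i = 0 -> \sum_i t i *: p i = 0 ->
  forall i, t i = 0.

Definition simplex (F : set E) : Prop :=
  exists (k : nat) (p : 'I_k -> E), aff_indep p /\ F = conv_hull (range p).

End Hulls.

Section Complexes.
Variables (R : realType) (m : nat).
Local Notation E := 'rV[R]_m.
Implicit Types (C : set (set E)) (F G : set E).

Definition polytopal_complex C : Prop :=
  [/\ finite_set C, C !=set0, forall F, C F -> polytope F,
      forall F G, C F -> polytope_face F G -> C G &
      forall F G, C F -> C G ->
        polytope_face F (F `&` G) /\ polytope_face G (F `&` G)].

Definition facet C F : Prop :=
  C F /\ forall G, C G -> F `<=` G -> G = F.

(* The value of aff_dim on the empty set is irrelevant: the empty face is a
   facet only of the complex whose sole member is the empty set. *)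
Definition pure_complex C : Prop :=
  forall F G, facet C F -> facet C G -> aff_dim F = aff_dim G.

Definition simplicial C : Prop := forall F, C F -> simplex F.

Definition boundary_complex F : set (set E) :=
  [set G | polytope_face F G /\ G <> F].

Definition facet_ordering C (s : seq (set E)) : Prop :=
  uniq s /\ forall F, F \in s <-> facet C F.

Definition union_seq (s : seq (set E)) : set E := \bigcup_(F in [set` s]) F.

(* Complexes contain the empty face, so "a set of points" means that every
   face has at most one point.  This also counts the complex {set0} as
   shellable; that complex never occurs in the recursion of ShellingStep for
   a complex that is not itself a set of points.
   Boundary complexes of polytopes are automatically pure polytopal complexes,
   so this requirement is imposed only once, in [shellable]. *)
Inductive shelling : set (set E) -> seq (set E) -> Prop :=
| ShellingPoints C s of
    facet_ordering C s & (forall F, C F -> is_subset1 F) : shelling C s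
| ShellingStep C F1 s of
    facet_ordering C (F1 :: s) &
    (exists t, shelling (boundary_complex F1) t) &
    (forall s1 F s2, s = s1 ++ F :: s2 ->
      exists G G' : seq (set E),
        [/\ G <> [::], shelling (boundary_complex F) (G ++ G') &
            F `&` union_seq (F1 :: s1) = union_seq G]) : shelling C (F1 :: s).

Definition shellable C : Prop :=
  [/\ polytopal_complex C, pure_complex C & exists s, shelling C s].

End Complexes.

Section Barycentric.
Variables (R : realType) (n : nat).
Local Notation E := 'rV[R]_n.

Definition latt (v : 'rV[int]_n) : E := map_mx intr v.
Definition ratv (v : 'rV[rat]_n) : E := map_mx ratr v.
Definition ratf (f : 'cV[rat]_n) : 'cV[R]_n := map_mx ratr f.

Definition rational_polyhedral_cone (sigma : set E) : Prop :=
  exists2 A : set 'rV[int]_n, finite_set A & sigma = cone_hull (latt @` A).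

Definition slice (l : 'cV[rat]_n) (A : set E) : set E :=
  A `&` [set x | pairing (ratf l) x = 1].

(* [mu i] has dimension [i.+1] because 'I_n is indexed from 0. *)
Definition full_flag (sigma : set E) (mu : 'I_n -> set E) : Prop :=
  [/\ forall i, cone_face sigma (mu i),
      forall i j : 'I_n, (i <= j)%N -> mu i `<=` mu j,
      forall i : 'I_n, lin_dim (mu i) = i.+1 &
      forall i : 'I_n, i.+1 = n -> mu i = sigma].

(* Admissible choices of l and of the points rho_mu; the values of [rho] at
   sets other than nonzero faces of sigma are irrelevant. *)
Definition barycentric_choice (sigma : set E) (l : 'cV[rat]_n)
    (rho : set E -> 'rV[rat]_n) : Prop :=
  [/\ forall x, sigma x -> 0 <= pairing (ratf l) x,
      sigma `&` [set x | pairing (ratf l) x = 0] = [set 0] &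
      forall mu, cone_face sigma mu -> mu <> [set 0] ->
        slice l sigma (ratv (rho mu)) /\ relint mu (ratv (rho mu))].

(* The fan Sigma_Y: all faces of the cones spanned by full flags. *)
Definition barycentric_fan (sigma : set E) (rho : set E -> 'rV[rat]_n) :
    set (set E) :=
  [set tau | exists mu : 'I_n -> set E, full_flag sigma mu /\
     cone_face (cone_hull (range (fun i => ratv (rho (mu i))))) tau].

Definition slice_complex (l : 'cV[rat]_n) (Sigma : set (set E)) :
    set (set E) := slice l @` Sigma.

End Barycentric.

(* Main.v *)
Require Import Defs.
From mathcomp Require Import all_boot all_order all_algebra.
From mathcomp Require Import all_classical all_reals all_analysis.
From mathcomp Require Import ring lra zify.
Set Implicit Arguments.
Unset Strict Implicit.
Unset Printing Implicit Defensive.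
Import Order.TTheory GRing.Theory Num.Theory.
Import numFieldNormedType.Exports.
Local Open Scope classical_set_scope.
Local Open Scope ring_scope.

(* The barycentric subdivision is a regular triangulation: giving the vertex
   rho_mu the height - e^(n + 1 - dim mu), for a small e > 0, defines a convex
   function h on sigma, linear exactly on the cones of the full flags.  Let h_F
   be the linear form that agrees with h on the cone of the flag F.  For a
   generic point q of sigma, the simplices are ordered by decreasing h_F(q).  A
   simplex F then meets the union of the earlier ones exactly in its facets
   visible from q: if no facet of F through y is visible, then y + t q stays in
   the cone of F for small t, so no h_F' with F' through y can exceed h_F at q;
   conversely, for y in a visible facet, y + t q lies in the cone of some F'
   through y with h_F'(q) > h_F(q).  Facets on the boundary of sigma are never
   visible, and any ordering of the facets of a simplex is a shelling of its
   boundary. *)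

(** * Polyhedral cones and their faces *)

Section Pairing.
Variables (R : realType) (n : nat).
Implicit Types (f g : 'cV[R]_n) (x y : 'rV[R]_n).

Lemma pairingD f x y : pairing f (x + y) = pairing f x + pairing f y.
Proof. by rewrite /pairing mulmxDl mxE. Qed.

Lemma pairingZ f (a : R) x : pairing f (a *: x) = a * pairing f x.
Proof. by rewrite /pairing -scalemxAl mxE. Qed.

Lemma pairingN f x : pairing f (- x) = - pairing f x.
Proof. by rewrite -scaleN1r pairingZ mulN1r. Qed.

Lemma pairingB f x y : pairing f (x - y) = pairing f x - pairing f y.
Proof. by rewrite pairingD pairingN. Qed.

Lemma pairing0 f : pairing f 0 = 0.
Proof. by rewrite /pairing mul0mx mxE. Qed.

Lemma pairing_sum f (I : Type) (r : seq I) (P : pred I) (F : I -> 'rV[R]_n) :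
  pairing f (\sum_(i <- r | P i) F i) = \sum_(i <- r | P i) pairing f (F i).
Proof. exact: (big_morph _ (pairingD f) (pairing0 f)). Qed.

Lemma pairingDl f g x : pairing (f + g) x = pairing f x + pairing g x.
Proof. by rewrite /pairing mulmxDr mxE. Qed.

Lemma pairingZl (a : R) f x : pairing (a *: f) x = a * pairing f x.
Proof. by rewrite /pairing -scalemxAr mxE. Qed.

Lemma pairingNl f x : pairing (- f) x = - pairing f x.
Proof. by rewrite -scaleN1r pairingZl mulN1r. Qed.

Lemma pairing_delta (i : 'I_n) x : pairing (delta_mx i 0) x = x 0 i.
Proof. by rewrite /pairing -colE mxE. Qed.

(** The linear map [y - projv U y] kills [U] but not [x], so one of its coordinates, rescaled, is
    the required form. *)
Lemma separating_form (U : {vspace 'rV[R]_n}) x : x \notin U ->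
  exists f, (forall y, y \in U -> pairing f y = 0) /\ pairing f x = 1.
Proof.
move=> xU; pose p y := y - projv U y.
have : p x != 0.
  by apply: contraNneq xU => /subr0_eq ->; exact: memv_proj.
have [[i pxi] _|p0 /eqP[]] := pselect (exists i, p x 0 i != 0); last first.
  apply/rowP => i; rewrite [RHS]mxE; apply/eqP.
  by apply: contra_notT p0 => ?; exists i.
pose f := \col_j p (delta_mx 0 j) 0 i.
have fE y : pairing f y = p y 0 i.
  rewrite /pairing mxE [in RHS](row_sum_delta y) /p raddf_sum -sumrB summxE.
  by apply: eq_bigr => j _ /=; rewrite linearZ /= -scalerBr !mxE.
exists ((p x 0 i)^-1 *: f); split=> [y yU|]; rewrite pairingZl fE ?mulVf //.
by rewrite {2}/p (projv_id yU) subrr [X in _ * X]mxE mulr0.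
Qed.
End Pairing.

(** * Finitely generated cones and half-spaces *)

Section Cones.
Variables (R : realType) (n : nat).
Local Notation E := 'rV[R]_n.
Implicit Types (A : set E) (s : seq E) (f g : 'cV[R]_n) (x y z : E).

Lemma cone_hull0 A : cone_hull A 0.
Proof.
exists 0%N, (fun=> 0), (fun=> 0); split; [by case|by case|].
by rewrite big_ord0.
Qed.

Lemma cone_hull_gen A x : A x -> cone_hull A x.
Proof.
move=> Ax; exists 1%N, (fun=> x), (fun=> 1); split=> //.
by rewrite big_ord1 scale1r.
Qed.

Lemma cone_hullZ A x (c : R) : 0 <= c -> cone_hull A x -> cone_hull A (c *: x).
Proof.
move=> c0 [k [a [t [Aa t0 ->]]]].
exists k, a, (fun i => c * t i); split=> // [i|]; first exact: mulr_ge0.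
by rewrite scaler_sumr; apply: eq_bigr => i _; rewrite scalerA.
Qed.

Lemma cone_hullD A x y : cone_hull A x -> cone_hull A y -> cone_hull A (x + y).
Proof.
move=> [k [a [t [Aa t0 ->]]]] [k' [a' [t' [Aa' t'0 ->]]]].
pose glue T (u : 'I_k -> T) (v : 'I_k' -> T) (i : 'I_(k + k')) :=
  match fintype.split i with inl j => u j | inr j => v j end.
exists (k + k')%N, (glue _ a a'), (glue _ t t'); split.
- by move=> i; rewrite /glue; case: fintype.split.
- by move=> i; rewrite /glue; case: fintype.split.
rewrite big_split_ord /=; congr (_ + _); apply: eq_bigr => i _; rewrite /glue.
- by rewrite (unsplitK (inl i)).
- by rewrite (unsplitK (inr i)).
Qed.

Lemma cone_hull_min A (C : set E) : A `<=` C -> C 0 ->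
  (forall x y, C x -> C y -> C (x + y)) ->
  (forall (c : R) x, 0 <= c -> C x -> C (c *: x)) -> cone_hull A `<=` C.
Proof.
move=> AC C0 CD CZ _ [k [a [t [Aa t0 ->]]]].
elim/big_ind : _ => // i _; apply: CZ => //; exact: AC.
Qed.

Lemma cone_hullS A A' : A `<=` A' -> cone_hull A `<=` cone_hull A'.
Proof.
move=> AA'; apply: cone_hull_min; [|exact: cone_hull0|exact: cone_hullD|].
- by move=> x /AA'; exact: cone_hull_gen.
- by move=> c x; exact: cone_hullZ.
Qed.

Lemma cone_hull_ge0 A f : (forall x, A x -> 0 <= pairing f x) ->
  forall x, cone_hull A x -> 0 <= pairing f x.
Proof.
move=> Af; apply: cone_hull_min => //=; first by rewrite pairing0.
- by move=> x y fx fy; rewrite pairingD addr_ge0.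
- by move=> c x c0 fx; rewrite pairingZ mulr_ge0.
Qed.

Lemma cone_hull_cons a s x : cone_hull [set` a :: s] x <->
  exists2 t : R, 0 <= t & cone_hull [set` s] (x - t *: a).
Proof.
split=> [|[t t0 xs]]; last first.
  rewrite -(subrK (t *: a) x); apply: cone_hullD.
  - by move: xs; apply: cone_hullS => y /=; rewrite inE orbC => ->.
  - by apply/cone_hullZ/cone_hull_gen => //=; rewrite mem_head.
move: x; apply: cone_hull_min => [y||y z [t t0 yt] [u u0 zu]|c y c0 [t t0 yt]].
- rewrite /= inE => /predU1P[->|ys].
    by exists 1 => //; rewrite scale1r subrr; exact: cone_hull0.
  by exists 0 => //; rewrite scale0r subr0; exact: cone_hull_gen.
- by exists 0 => //; rewrite scale0r subr0; exact: cone_hull0.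
- exists (t + u); first exact: addr_ge0.
  by rewrite scalerDl opprD addrACA; exact: cone_hullD.
- exists (c * t); first exact: mulr_ge0.
  by rewrite -scalerA -scalerBr; exact: cone_hullZ.
Qed.

(** Solves a finite system of bounds on one scalar. Either list may be empty; with [U] empty it
    gives an upper bound of a finite list. *)
Lemma seq_between (L U : seq R) : (forall a b, a \in L -> b \in U -> a <= b) ->
  exists t, (forall a, a \in L -> a <= t) /\ (forall b, b \in U -> t <= b).
Proof.
elim: L => [_|a L IH LU].
  elim: U => [|b U [t [_ tU]]]; first by exists 0.
  exists (Num.min b t); split=> // c; rewrite inE ge_min => /predU1P[->|/tU->].
    by rewrite lexx.
  by rewrite orbT.
have [|t [Lt tU]] := IH.
  by move=> c b cL bU; apply: LU => //; rewrite inE cL orbT.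
exists (Num.max a t); split=> c.
  rewrite inE le_max => /predU1P[->|/Lt->]; by rewrite ?lexx ?orbT.
by move=> cU; rewrite ge_max tU // LU // mem_head.
Qed.

(* Weyl's theorem: Fourier-Motzkin elimination of the scalar [t] of
   [cone_hull_cons] produces the half-spaces of a cone from those of the cone
   with one generator less. *)
Lemma cone_hull_halfspaces s : exists B : seq 'cV[R]_n,
  forall x, cone_hull [set` s] x <-> forall f, f \in B -> 0 <= pairing f x.
Proof.
elim: s => [|a s [B BP]].
  (* Without generators the cone is the origin, cut out by the coordinate forms and their
     opposites. *)
  exists ([seq delta_mx i 0 | i <- enum 'I_n] ++
          [seq - delta_mx i 0 | i <- enum 'I_n]) => x.
  have hn : cone_hull [set` ([::] : seq E)] `<=` [set 0].
    apply: cone_hull_min => //= [y z -> ->|c y _ ->].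
    - by rewrite addr0.
    - by rewrite scaler0.
  split=> [/hn -> f _|H]; first by rewrite pairing0.
  suff -> : x = 0 by exact: cone_hull0.
  apply/rowP => i; rewrite mxE; apply: le_anti; apply/andP; split.
    rewrite -oppr_ge0 -pairing_delta -pairingNl; apply: H.
    by rewrite mem_cat (map_f (fun i => - delta_mx i 0)) ?orbT ?mem_enum.
  rewrite -pairing_delta; apply: H.
  by rewrite mem_cat (map_f (fun i => delta_mx i 0)) ?mem_enum.
(* Forms nonnegative at [a] are kept; two forms of opposite strict signs at [a] are combined, with
   positive coefficients, into one that vanishes at [a]. *)
exists ([seq f <- B | 0 <= pairing f a] ++
  [seq pairing f a *: g - pairing g a *: f |
     f <- [seq f <- B | 0 < pairing f a], g <- [seq f <- B | pairing f a < 0]]).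
move=> x; rewrite cone_hull_cons; split=> [[t t0 /BP xt] f|H].
  rewrite mem_cat mem_filter => /orP[/andP[fa fB]|/allpairsP[[g h] /=]].
    have := xt f fB; rewrite pairingB pairingZ subr_ge0; apply: le_trans.
    exact: mulr_ge0.
  rewrite !mem_filter => -[/andP[ga gB] /andP[ha hB] ->].
  have := xt g gB; have := xt h hB.
  rewrite pairingDl pairingNl !pairingZl !pairingB !pairingZ.
  move: (pairing g a) (pairing h a) (pairing g x) (pairing h x) ga ha.
  move=> u v y z u0 v0 zv yu.
  have -> : u * z - v * y = u * (z - t * v) + - v * (y - t * u) by ring.
  by rewrite addr_ge0 // mulr_ge0 // ?oppr_ge0 ltW.
(* A form bounds [t] by the ratio of its values at [x] and [a], from above or below according to its
   sign at [a]; the added [0] enforces [0 <= t]. *)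
have [|t [Lt tU]] := @seq_between
   (0 :: [seq pairing f x / pairing f a | f <- B & pairing f a < 0])
   [seq pairing f x / pairing f a | f <- B & 0 < pairing f a].
  move=> c _ cL /mapP[f + ->]; rewrite mem_filter => /andP[fa fB].
  move: cL; rewrite inE => /predU1P[->|/mapP[g + ->]].
    rewrite divr_ge0 // ?(ltW fa) //; apply: H.
    by rewrite mem_cat mem_filter fB ltW.
  rewrite mem_filter => /andP[ga gB].
  rewrite ler_pdivlMr // mulrAC ler_ndivrMr // -subr_ge0.
  have := H (pairing f a *: g - pairing g a *: f).
  rewrite pairingDl pairingNl !pairingZl mulrC [pairing g a * _]mulrC.
  apply; rewrite mem_cat; apply/orP; right.
  by apply: (allpairs_f (fun f g => pairing f a *: g - pairing g a *: f));
    rewrite mem_filter ?fa ?ga.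
exists t; first by apply: Lt; rewrite mem_head.
apply/BP => f fB; rewrite pairingB pairingZ subr_ge0.
have [fa|fa|fa] := ltrgt0P (pairing f a).
- rewrite -ler_pdivlMr //; apply: tU.
  by apply/mapP; exists f; rewrite // mem_filter fa.
- rewrite -ler_ndivrMr //; apply: Lt; rewrite inE; apply/orP; right.
  by apply/mapP; exists f; rewrite // mem_filter fa.
- by rewrite fa mulr0; apply: H; rewrite mem_cat mem_filter fB fa lexx.
Qed.

End Cones.

(** * Linear spans and dimension *)

Section LinSpan.
Variables (R : realType) (n : nat).
Implicit Types (A : set 'rV[R]_n) (f : 'cV[R]_n).

Lemma mem_lin_span A x : A x -> x \in lin_span A.
Proof. by move=> Ax; exact: (lin_spanP A (lin_span A)).2 (subvv _) x Ax. Qed.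

Lemma lin_spanS A A' : A `<=` A' -> (lin_span A <= lin_span A')%VS.
Proof. by move=> AA'; apply/lin_spanP => x /AA' /mem_lin_span. Qed.

Lemma pairing_lin_span0 A f : (forall x, A x -> pairing f x = 0) ->
  forall x, x \in lin_span A -> pairing f x = 0.
Proof.
move=> Af x xA; have /subvP /(_ x xA) :
    (lin_span A <= lker (linfun (mulmxr f : 'rV[R]_n -> 'rV[R]_1)))%VS.
  apply/lin_spanP => y /Af fy /=; rewrite memv_ker lfunE /=; apply/eqP/rowP => i.
  by rewrite ord1 [RHS]mxE.
by rewrite memv_ker lfunE /= => /eqP fx; rewrite /pairing fx mxE.
Qed.

Lemma lin_dim0P A : lin_dim A = 0%N -> forall x, A x -> x = 0.
Proof.
move/eqP; rewrite dimv_eq0 => /eqP A0 x /mem_lin_span.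
by rewrite A0 memv0 => /eqP.
Qed.

Lemma lin_dim_set0 : lin_dim ([set 0] : set 'rV[R]_n) = 0%N.
Proof.
apply/eqP; rewrite dimv_eq0 -subv0; apply/lin_spanP => x -> /=.
exact: mem0v.
Qed.

End LinSpan.

(** Selects the binding constraint in the ratio tests of [cone_facet_through] and [exit_face]. *)
Lemma seq_argmin (R : realType) (T : eqType) (h : T -> R) (s : seq T) :
  s != [::] -> exists2 a, a \in s & forall b, b \in s -> h a <= h b.
Proof.
elim: s => // a s IH _; have [->|/IH[b bs bmin]] := eqVneq s [::].
  by exists a => [|b]; rewrite ?mem_head // inE => /eqP ->.
have [ab|ba] := leP (h a) (h b).
  exists a => [|c]; rewrite ?mem_head // inE => /predU1P[-> //|/bmin].
  exact: le_trans.
exists b => [|c]; rewrite inE ?bs ?orbT // => /predU1P[->|/bmin //].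
exact: ltW.
Qed.

(** * Faces of finitely generated cones *)

Section Faces.
Variables (R : realType) (n : nat).
Local Notation E := 'rV[R]_n.
Implicit Types (mu nu : set E) (s : seq E) (f g : 'cV[R]_n) (x y z : E).

Lemma cone_face_refl mu : cone_face mu mu.
Proof.
exists 0; split=> [x _|]; first by rewrite /pairing mulmx0 mxE.
by apply/seteqP; split=> [x mux|x []//]; split=> //=; rewrite /pairing mulmx0 mxE.
Qed.

Lemma cone_face_sub mu nu : cone_face mu nu -> nu `<=` mu.
Proof. by move=> [f [_ ->]] x []. Qed.

(** A vanishing sum of nonnegative terms has only zero terms, so a point of the face uses only
    generators at which the form is zero. *)
Lemma cone_face_gen s mu : cone_face (cone_hull [set` s]) mu ->
  exists p : pred E, mu = cone_hull [set` seq.filter p s].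
Proof.
move=> [f [f0 ->]]; exists (fun a => pairing f a == 0).
apply/seteqP; split=> [x [[k [a [t [ak t0 ->]]]]] /= fx|x xs]; last first.
  split.
    by move: xs; apply: cone_hullS => a /=; rewrite mem_filter => /andP[].
  move: xs; move: x; apply: cone_hull_min => [a /=|/=|x y /= fx fy|c x _ /= fx].
  - by rewrite mem_filter => /andP[/eqP].
  - exact: pairing0.
  - by rewrite pairingD fx fy addr0.
  - by rewrite pairingZ fx mulr0.
have fi0 i : 0 <= pairing f (t i *: a i).
  by rewrite pairingZ mulr_ge0 //; apply/f0/cone_hull_gen.
move: fx; rewrite pairing_sum => /eqP; rewrite psumr_eq0 // => /allP fx.
elim/big_ind : _ => [||i _]; [exact: cone_hull0|exact: cone_hullD|].
have := fx i (mem_index_enum i); rewrite pairingZ mulf_eq0.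
case/orP => [/eqP ->|fa]; first by rewrite scale0r; exact: cone_hull0.
by apply/cone_hullZ/cone_hull_gen => //=; rewrite mem_filter fa ak.
Qed.

(** If [g] cuts out [mu] and [f] cuts [nu] out of [mu], then [f] plus a large multiple of [g] cuts
    out [nu]. *)
Lemma cone_face_trans s mu nu :
  cone_face (cone_hull [set` s]) mu -> cone_face mu nu ->
  cone_face (cone_hull [set` s]) nu.
Proof.
move=> [g [g0 muE]] [f [f0 ->]].
(* [C] makes [f + C *: g] nonnegative on the generators outside [mu]. Where [g] vanishes the ratio
   is the default 0, which is harmless. *)
have [C [Cs _]] := @seq_between R [seq - pairing f a / pairing g a | a <- s] [::]
  (fun _ _ _ => ltac:(by [])).
have h0 x : cone_hull [set` s] x -> 0 <= pairing (f + C *: g) x.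
  apply: cone_hull_ge0 => a /= sa; rewrite pairingDl pairingZl.
  have sa' := cone_hull_gen (sa : [set` s] a).
  have := g0 a sa'; rewrite le0r => /orP[/eqP ga|ga].
    by rewrite ga mulr0 addr0; apply: f0; rewrite muE.
  rewrite addrC -[X in _ + X]opprK subr_ge0 -ler_pdivrMr //.
  by apply: Cs; apply: (map_f (fun a => - pairing f a / pairing g a)).
(* The form [f + C *: g] may also vanish outside [mu]; the extra [g] forces the zeros back into
   [mu]. *)
exists (f + C *: g + g); split=> [x sx|].
  by rewrite pairingDl addr_ge0 ?h0 ?g0.
apply/seteqP; split=> x; rewrite muE /=.
  move=> [[sx gx] fx]; split=> //.
  by rewrite !pairingDl pairingZl fx gx mulr0 !addr0.
move=> [sx /eqP]; rewrite pairingDl paddr_eq0 ?h0 ?g0 // => /andP[/eqP hx /eqP gx].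
by move: hx; rewrite pairingDl pairingZl gx mulr0 addr0.
Qed.

(** The form that cuts out [nu] vanishes on the whole span of [nu]. *)
Lemma cone_face_lin_span mu nu x :
  cone_face mu nu -> mu x -> x \in lin_span nu -> nu x.
Proof.
move=> [f [_ ->]] mux xnu; split=> //=.
by apply: pairing_lin_span0 xnu => y [].
Qed.

(* As long as [mu ∩ f^⊥] has codimension at least two, rotating [f] around its
   span until it meets a further generator yields a larger proper face. *)
Lemma cone_facet_through s f z :
  let mu := cone_hull [set` s] in
  (forall x, mu x -> 0 <= pairing f x) -> mu z -> pairing f z = 0 ->
  (exists2 u, mu u & pairing f u != 0) ->
  exists nu, [/\ cone_face mu nu, nu z & lin_dim mu = (lin_dim nu).+1].
Proof.
move=> mu; pose N f := mu `&` [set x | pairing f x = 0].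
have Nf g : (forall x, mu x -> 0 <= pairing g x) -> cone_face mu (N g).
  by move=> g0; exists g.
have strict (W W' : set E) a : W `<=` W' -> lin_dim W = lin_dim W' -> W' a ->
    a \in lin_span W.
  move=> /lin_spanS sub dimE W'a; suff -> : lin_span W = lin_span W'.
    exact: mem_lin_span.
  by apply/eqP; rewrite eqEdim sub /=; move: dimE; rewrite /lin_dim => ->.
have dimN g : (forall x, mu x -> 0 <= pairing g x) ->
    (exists2 u, mu u & pairing g u != 0) -> (lin_dim (N g) < lin_dim mu)%N.
  move=> g0 [u muu gu]; have sub := cone_face_sub (Nf g g0).
  rewrite ltn_neqAle dimvS ?lin_spanS // andbT; apply: contraNneq gu => dimE.
  have [_ /= ->] : N g u by
    apply: (cone_face_lin_span (Nf g g0) muu);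
    exact: strict (cone_face_sub (Nf g g0)) dimE muu.
  exact: eqxx.
move: {2}(lin_dim mu - lin_dim (N f))%N (leqnn (lin_dim mu - lin_dim (N f))).
move=> k; elim: k f => [|k IH] f fk f0 muz fz [u muu fu];
  have {}dimN := dimN f f0 (ex_intro2 _ _ u muu fu).
  by move: fk dimN; lia.
have [dimE|dimE] := eqVneq (lin_dim mu) (lin_dim (N f)).+1.
  by exists (N f); split=> //; exact: Nf.
(* A form vanishing on [V] leaves the value of [f] at [u] unchanged, so the rotated form stays
   nonzero on [mu]. In codimension at least two, [V] misses some generator. *)
pose V := (lin_span (N f) + <[u]>)%VS.
have dimV : (\dim V < lin_dim mu)%N.
  have : (\dim V <= lin_dim (N f) + 1)%N.
    rewrite (leq_trans (dimv_add_leqif _ _)) // leq_add2l dim_vline.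
    by case: (_ != _).
  by move: dimN dimE; lia.
have [a1 a1s a1V] : exists2 a, a \in s & a \notin V.
  have [[a]|noa] := pselect (exists a, a \in s /\ a \notin V).
    by case=> ? ?; exists a.
  suff : (lin_span mu <= V)%VS by move/dimvS; rewrite leqNgt dimV.
  apply/lin_spanP; apply: cone_hull_min => /= [a sa||x y xV yV|c x _ xV].
  - by apply: contra_notT noa => aV; exists a.
  - exact: mem0v.
  - exact: memvD.
  - exact: memvZ.
have [g [gV ga1]] := separating_form a1V.
have [a] : exists2 a, a \in [seq a <- s | 0 < pairing g a] &
    forall b, b \in [seq a <- s | 0 < pairing g a] ->
      pairing f a / pairing g a <= pairing f b / pairing g b.
  apply: (seq_argmin (fun a => pairing f a / pairing g a)).
  apply/eqP => nil; have : a1 \in [seq a <- s | 0 < pairing g a].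
    by rewrite mem_filter ga1 ltr01.
  by rewrite nil.
rewrite mem_filter => /andP[ga sa] amin.
(* The largest [c] for which [f - c *: g] is nonnegative on the generators. The new form vanishes at
   [a], which is outside the span of [N f] because [g] is positive there. *)
pose c := pairing f a / pairing g a.
have f0s b : b \in s -> 0 <= pairing f b by move=> sb; apply/f0/cone_hull_gen.
have c0 : 0 <= c by rewrite divr_ge0 ?f0s // ltW.
pose h := f - c *: g.
have hE x : pairing h x = pairing f x - c * pairing g x.
  by rewrite pairingDl pairingNl pairingZl.
have h0 x : mu x -> 0 <= pairing h x.
  apply: cone_hull_ge0 => b /= sb; rewrite hE subr_ge0.
  have [gb|gb] := ltP 0 (pairing g b).
    by rewrite -ler_pdivlMr //; apply: amin; rewrite mem_filter gb.
  by rewrite (le_trans _ (f0s b sb)) // mulr_ge0_le0.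
have gN x : N f x -> pairing g x = 0.
  by move=> Nx; apply: gV; rewrite -[x]addr0 memv_add ?mem0v // mem_lin_span.
have hu : pairing h u = pairing f u.
  rewrite hE gV ?mulr0 ?subr0 //.
  by rewrite -[u]add0r memv_add ?mem0v // memv_line.
apply: (IH h) => //.
- have : (lin_dim (N f) < lin_dim (N h))%N; last by move: fk dimN; lia.
  have sub : N f `<=` N h.
    move=> x Nx; split; first by case: Nx.
    by case: (Nx) => _ /= fx; rewrite hE fx gN // mulr0 subr0.
  rewrite ltn_neqAle dimvS ?lin_spanS // andbT; apply/eqP => dimE'.
  have : a \in lin_span (N f).
    apply: strict sub dimE' _; split; first exact: cone_hull_gen.
    by rewrite /= hE /c divfK ?subrr // gt_eqF.
  by move=> /(pairing_lin_span0 gN) ga0; rewrite ga0 ltxx in ga.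
- by rewrite hE fz gN ?mulr0 ?subr0.
- by exists u; rewrite // hu.
Qed.

(** From a relative interior point one can move a little away from [y] without leaving [mu]; if [f]
    were positive at [y], it would become negative there. *)
Lemma relint_form0 mu x f : relint mu x ->
  (forall y, mu y -> 0 <= pairing f y) -> pairing f x = 0 ->
  forall y, mu y -> pairing f y = 0.
Proof.
move=> xi f0 fx y muy; have mux : mu x by exact: interior_subset xi.
(* The neighbourhoods of [x] are taken within the affine hull, so the ray must be known to stay in
   it. *)
have hull_ray (e : R) : aff_hull mu (x - e *: (y - x)).
  exists 2%N, (fun i : 'I_2 => if i == 0 then x else y),
    (fun i : 'I_2 => if i == 0 then 1 + e else - e); split.
  - by move=> i; case: (i == 0).
  - by rewrite !big_ord_recl big_ord0 /=; ring.
  - rewrite !big_ord_recl big_ord0 /= addr0 scalerBr scalerDl scale1r scaleNr.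
    by rewrite opprB addrA.
have near_mu : within (aff_hull mu) (nbhs x) mu.
  rewrite nbhs_subspace_in; first exact: xi.
  by have := hull_ray 0; rewrite scale0r subr0.
have cont : (fun e : R => x - e *: (y - x)) @ (0 : R) --> x.
  have -> : nbhs x = nbhs (x - 0 *: (y - x)) by rewrite scale0r subr0.
  by apply: cvgB; [exact: cvg_cst|apply: cvgZl; exact: cvg_id].
have /nbhs_ballP[e /= e0 he] := cont _ near_mu.
have mue : mu (x - (e / 2) *: (y - x)).
  apply: he (hull_ray _); rewrite /ball /= sub0r normrN gtr0_norm ?divr_gt0 //.
  by rewrite ltr_pdivrMr // ltr_pMr // ltr1n.
apply: le_anti; rewrite f0 // andbT.
have := f0 _ mue; rewrite pairingB pairingZ pairingB fx subr0 sub0r oppr_ge0.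
by rewrite pmulr_rle0 // divr_gt0.
Qed.

End Faces.

(** * Simplices in the hyperplane [L = 1] *)

Lemma map_cat_cons (T U : Type) (f : T -> U) (s : seq T) s1 y s2 :
  map f s = s1 ++ y :: s2 ->
  exists r1 x r2, [/\ s = r1 ++ x :: r2, s1 = map f r1, y = f x & s2 = map f r2].
Proof.
elim: s s1 => [|a s IH] [|b s1] //= [<-].
  by move=> <-; exists [::], a, s.
by move=> /IH[r1 [x [r2 [-> -> -> ->]]]]; exists (a :: r1), x, r2.
Qed.

Section Simplices.
Variables (R : realType) (n : nat) (L : 'cV[R]_n).
Local Notation E := 'rV[R]_n.
Implicit Types (B : 'M[R]_n) (I J : {set 'I_n}) (x y : E).

Definition coords B x : E := x *m invmx B.

Definition nonneg_on B x : Prop := forall i, 0 <= coords B x 0 i.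

(** The simplex on the rows of [B] indexed by [I], given by coordinates rather than as a hull, so
    that intersecting faces amounts to intersecting index sets. [splx_conv] recovers the hull. *)
Definition splx B I : set E :=
  [set x | [/\ pairing L x = 1, nonneg_on B x &
               forall i, i \notin I -> coords B x 0 i = 0]].

Definition slice_basis B : Prop := B \in unitmx /\ B *m L = const_mx 1.

Lemma coordsD B x y i : coords B (x + y) 0 i = coords B x 0 i + coords B y 0 i.
Proof. by rewrite /coords mulmxDl mxE. Qed.

Lemma coordsZ B (a : R) x i : coords B (a *: x) 0 i = a * coords B x 0 i.
Proof. by rewrite /coords -scalemxAl mxE. Qed.

Lemma coords_sum B (T : Type) (r : seq T) (P : pred T) (F : T -> E) i :
  coords B (\sum_(j <- r | P j) F j) 0 i =
  \sum_(j <- r | P j) coords B (F j) 0 i.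
Proof.
apply: (big_morph (fun x => coords B x 0 i)) => [x y|]; first exact: coordsD.
by rewrite /coords mul0mx mxE.
Qed.

Lemma splxS B I J : I \subset J -> splx B I `<=` splx B J.
Proof.
move=> /fintype.subsetP IJ x [Lx x0 xI].
by split=> // i iJ; apply: xI; apply: contraNN iJ; exact: IJ.
Qed.

Section OneSimplex.
Variable B : 'M[R]_n.
Hypothesis HB : slice_basis B.

Let Bu : B \in unitmx. Proof. by case: HB. Qed.

Lemma coords_row i j : coords B (row i B) 0 j = (i == j)%:R.
Proof. by rewrite /coords -row_mul mulmxV // !mxE. Qed.

Lemma coordsE x : x = \sum_i coords B x 0 i *: row i B.
Proof. by rewrite -mulmx_sum_row /coords mulmxKV. Qed.

Lemma coords_uniq x c : x = c *m B -> coords B x = c.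
Proof. by move=> ->; rewrite /coords mulmxK. Qed.

Lemma pairing_coords f x :
  pairing f x = \sum_i coords B x 0 i * pairing f (row i B).
Proof.
rewrite {1}(coordsE x) pairing_sum; apply: eq_bigr => i _.
by rewrite pairingZ.
Qed.

Lemma pairing_row i : pairing L (row i B) = 1.
Proof. by case: HB => _ BL; rewrite /pairing -row_mul BL !mxE. Qed.

Lemma sum_coords x : \sum_i coords B x 0 i = pairing L x.
Proof.
by rewrite pairing_coords; apply: eq_bigr => i _; rewrite pairing_row mulr1.
Qed.

Lemma splx_row I i : i \in I -> splx B I (row i B).
Proof.
move=> iI; split; first exact: pairing_row.
- by move=> j; rewrite coords_row.
- by move=> j jI; rewrite coords_row (negPf (memPn jI i iI)).
Qed.

Lemma splx_subset I J : (splx B I `<=` splx B J) <-> I \subset J.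
Proof.
split=> [IJ|]; last exact: splxS.
apply/fintype.subsetP => i /splx_row /IJ [_ _ xJ]; apply: contraT => /xJ/eqP.
by rewrite coords_row eqxx oner_eq0.
Qed.

Lemma splx_inj : injective (splx B).
Proof.
move=> I J IJ; apply/eqP; rewrite finset.eqEsubset.
by apply/andP; split; apply/splx_subset; rewrite IJ.
Qed.

Lemma splxI I J : splx B I `&` splx B J = splx B (I :&: J).
Proof.
apply/seteqP; split=> [x [[Lx x0 xI] [_ _ xJ]]|x xIJ].
  by split=> // i; rewrite inE negb_and => /orP[/xI|/xJ].
by split; move: xIJ; apply: splxS; rewrite ?finset.subsetIl ?finset.subsetIr.
Qed.

Lemma splx_conv I :
  splx B I = conv_hull (range (fun j : 'I_#|I| => row (enum_val j) B)).
Proof.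
apply/seteqP; split=> [x [Lx x0 xI]|_ [k [a [t [aI t0 t1 ->]]]]].
  have sumI (V : nmodType) (F : 'I_n -> V) : (forall i, i \notin I -> F i = 0) ->
      \sum_i F i = \sum_(j < #|I|) F (enum_val j).
    move=> F0; rewrite -(big_enum_val F) [RHS]big_mkcond /=.
    by apply: eq_bigr => i _; case: ifPn => // /F0.
  exists #|I|, (fun j => row (enum_val j) B), (fun j => coords B x 0 (enum_val j)).
  split=> [j|j||]; [by exists j|exact: x0| |].
  - by rewrite -Lx -sum_coords sumI.
  - by rewrite {1}(coordsE x) sumI // => i /xI ->; rewrite scale0r.
have {}aI i : splx B I (a i).
  by have [j _ <-] := aI i; apply: splx_row; exact: enum_valP.
split.
- rewrite pairing_sum -t1; apply: eq_bigr => i _.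
  by have [La _ _] := aI i; rewrite pairingZ La mulr1.
- move=> j; rewrite coords_sum sumr_ge0 // => i _; rewrite coordsZ mulr_ge0 //.
  by have [_ a0 _] := aI i.
- move=> j jI; rewrite coords_sum big1 // => i _; rewrite coordsZ.
  by have [_ _ ->] := aI i; rewrite ?mulr0.
Qed.

Lemma splx_simplex I : simplex (splx B I).
Proof.
exists #|I|, (fun j => row (enum_val j) B); split; last exact: splx_conv.
move=> t _ t0 j; have /(congr1 (fun x => coords B x 0 (enum_val j))) := t0.
rewrite coords_sum (bigD1 j) //= coordsZ coords_row eqxx mulr1.
rewrite big1 => [|i ij]; first by rewrite addr0 /coords mul0mx mxE.
by rewrite coordsZ coords_row (inj_eq enum_val_inj) (negPf ij) mulr0.
Qed.

Lemma splx_polytope I : polytope (splx B I).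
Proof.
exists (range (fun j : 'I_#|I| => row (enum_val j) B)); last exact: splx_conv.
exact/finite_image/finite_finset.
Qed.

(** A valid inequality is tight at a point exactly when it is tight at every vertex with nonzero
    coordinate. The empty [J] gives the empty face. *)
Lemma polytope_face_splx I G :
  polytope_face (splx B I) G <-> exists2 J : {set 'I_n}, J \subset I & G = splx B J.
Proof.
split=> [[f [c [fc ->]]]|[J JI ->]].
  exists [set i in I | pairing f (row i B) == c].
    by apply/fintype.subsetP => i; rewrite inE => /andP[].
  have sumE x : splx B I x ->
      \sum_i coords B x 0 i * (c - pairing f (row i B)) = c - pairing f x.
    move=> [Lx _ _]; under eq_bigr do rewrite mulrBr.
    by rewrite sumrB -mulr_suml sum_coords Lx mul1r -pairing_coords.
  have ge0 x : splx B I x ->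
      forall i, true -> 0 <= coords B x 0 i * (c - pairing f (row i B)).
    move=> [Lx x0 xI] i _; have [/splx_row/fc fi|/xI ->] := boolP (i \in I).
      by rewrite mulr_ge0 // subr_ge0.
    by rewrite mul0r.
  apply/seteqP; split=> x.
    move=> [xI /= fx0]; have /eqP := sumE x xI; rewrite fx0 subrr.
    rewrite psumr_eq0; last exact: ge0 xI.
    move=> /allP fx; split; [by case: xI|by case: xI|move=> i].
    rewrite inE negb_and => /orP[|fi]; first by case: xI => _ _; apply.
    have := fx i (mem_index_enum i); rewrite /= mulf_eq0 subr_eq0 [c == _]eq_sym.
    by rewrite (negPf fi) orbF => /eqP.
  move=> xJ; have xI : splx B I x.
    apply: (splxS _ xJ); apply/fintype.subsetP => i.
    by rewrite inE => /andP[].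
  split=> //=; apply/esym/subr0_eq; rewrite -sumE // big1 // => i _.
  have [|/eqP fi] := eqVneq (pairing f (row i B)) c.
    by move=> ->; rewrite subrr mulr0.
  case: xJ => _ _ ->; rewrite ?mul0r // inE negb_and; apply/orP; right.
  exact/eqP.
(* The sum of the coordinates in [J]: at most 1 on the simplex, with equality exactly on the face of
   [J]. *)
pose f := invmx B *m \col_i (i \in J)%:R.
have fE x : pairing f x = \sum_(i in J) coords B x 0 i.
  rewrite /pairing mulmxA mxE [RHS]big_mkcond /=; apply: eq_bigr => i _.
  by rewrite [X in _ * X]mxE; case: ifP => _; rewrite ?mulr1 ?mulr0.
have fC x : pairing L x = pairing f x + \sum_(i | i \notin J) coords B x 0 i.
  by rewrite -sum_coords fE (bigID (mem J)).
exists f, 1; split=> [x [Lx x0 _]|].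
  by rewrite -Lx fC lerDl sumr_ge0.
apply/seteqP; split=> x.
  move=> xJ; have xI := splxS JI xJ.
  case: xJ => Lx x0 xJ; split=> //=; by rewrite -Lx fC big1 ?addr0.
move=> [[Lx x0 xI] /= fx]; split=> // i iJ.
have /eqP : \sum_(i | i \notin J) coords B x 0 i = 0.
  by apply: (addrI 1); rewrite addr0 -{1}fx -fC.
rewrite psumr_eq0 => [/allP/(_ i (mem_index_enum i))|j _]; last exact: x0.
by rewrite iJ => /eqP.
Qed.

Lemma facet_boundary_splx I F :
  facet (boundary_complex (splx B I)) F <->
  exists2 i, i \in I & F = splx B (I :\ i).
Proof.
have inbd J : J \proper I -> boundary_complex (splx B I) (splx B J).
  move=> JI; split; first by apply/polytope_face_splx; exists J; rewrite ?proper_sub.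
  by move/splx_inj => JE; rewrite JE fintype.properxx in JI.
have bdin G : boundary_complex (splx B I) G ->
    exists2 J : {set 'I_n}, J \proper I & G = splx B J.
  move=> [/polytope_face_splx[J JI ->] JnI]; exists J => //.
  by rewrite finset.properEneq JI andbT; apply: contra_notN JnI => /eqP ->.
split=> [[/bdin[J JI ->] Jmax]|[i iI ->]].
  have /properP[_ [i iI iJ]] := JI; exists i => //; apply/esym/Jmax.
    exact/inbd/properD1.
  by apply/splx_subset; rewrite finset.subsetD1 proper_sub.
split; first exact/inbd/properD1.
move=> _ /bdin[J JI ->] /splx_subset sub; congr (splx B _); apply/eqP.
rewrite eq_sym eqEcard sub; have := proper_card JI.
by rewrite (cardsD1 i I) iI.
Qed.

Lemma union_seqP (s : seq (set E)) x :
  union_seq s x <-> exists2 F, F \in s & F x.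
Proof. by split=> [[F]|[F]]; exists F. Qed.

(** Induction on the number of vertices. The facet opposite [j] meets the one opposite [i] in its
    own facet opposite [i]; since any order is allowed, the facets met earlier may be listed
    first. *)
Lemma shelling_boundary_splx I (r : seq 'I_n) : uniq r -> r =i I ->
  shelling (boundary_complex (splx B I)) [seq splx B (I :\ i) | i <- r].
Proof.
elim: {r}(size r) {-2}r (erefl (size r)) I => [|k IH] r.
  (* For empty [I] the simplex is empty and its boundary complex has no member at all. *)
  move/size0nil => -> I _ rI; apply: ShellingPoints => [|F bF].
    split=> // F; split=> // /facet_boundary_splx[i]; by rewrite -rI.
  have [/polytope_face_splx[J + ->] []] := bF.
  suff -> : I = finset.set0 by rewrite finset.subset0 => /eqP ->.
  by apply/finset.setP => i; rewrite -rI !inE.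
case: r => // i1 r [rk] I; move=> /[dup] ruI /= /andP[i1r ru] rI.
have setD1_inj i j : i \in I -> I :\ i = I :\ j -> i = j.
  move=> iI /finset.setP/(_ i); rewrite !inE eqxx iI !andbT.
  by move=> /esym/negbFE/eqP ij; exact: ij.
rewrite /=; apply: ShellingStep.
- split.
    rewrite -[_ :: _]/(map (fun i => splx B (I :\ i)) (i1 :: r)) map_inj_in_uniq //.
    by move=> i j; rewrite rI => iI _ /splx_inj; exact: setD1_inj.
  rewrite -[_ :: _]/(map (fun i => splx B (I :\ i)) (i1 :: r)).
  move=> F; split=> [/mapP[i ir ->]|/facet_boundary_splx[i iI ->]].
    by apply/facet_boundary_splx; exists i; rewrite // -rI.
  by apply/mapP; exists i; rewrite ?rI.
- exists [seq splx B (I :\ i1 :\ i) | i <- r]; apply: IH => // i.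
  rewrite !inE -rI inE; have [->|//] := eqVneq i i1.
  exact: negbTE.
move=> s1 F s2 rmap; have [r1 [j [r2 [rE -> -> _]]]] := map_cat_cons rmap.
exists [seq splx B (I :\ j :\ i) | i <- i1 :: r1],
       [seq splx B (I :\ j :\ i) | i <- r2]; split=> //.
  rewrite -map_cat; have rperm : perm_eq (i1 :: r) (j :: (i1 :: r1) ++ r2).
    by rewrite rE -cat_cons -[j :: r2]cat1s perm_catCA.
  have := ruI; rewrite (perm_uniq rperm) => /andP[jr rju]; apply: IH => //.
    by have := perm_size rperm; rewrite /= rk => -[].
  move=> i; rewrite !inE -rI (perm_mem rperm) inE.
  by have [->|//] := eqVneq i j; exact: negbTE.
rewrite -[_ :: _]/(map (fun i => splx B (I :\ i)) (i1 :: r1)).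
have splx2 i : splx B (I :\ j :\ i) = splx B (I :\ j) `&` splx B (I :\ i).
  rewrite splxI; congr (splx B _); apply/finset.setP => h.
  by rewrite !inE; case: (h \in I); rewrite ?andbF ?andbT // andbC.
apply/seteqP; split=> x.
  move=> [xj /union_seqP[_ /mapP[i ir ->] xi]]; apply/union_seqP.
  exists (splx B (I :\ j :\ i)); last by rewrite splx2.
  exact: (map_f (fun i => splx B (I :\ j :\ i))).
move=> /union_seqP[_ /mapP[i ir ->]]; rewrite splx2 => -[xj xi]; split=> //.
apply/union_seqP; exists (splx B (I :\ i)) => //.
by apply: (map_f (fun i => splx B (I :\ i))).
Qed.

End OneSimplex.
End Simplices.

(** * Regular triangulations *)

Section SmallScalars.
Variable R : realType.

Lemma common_small (T : eqType) (s : seq T) (P : T -> R -> Prop) :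
  (forall i, i \in s ->
     exists2 e, 0 < e & forall d, 0 < d -> d <= e -> P i d) ->
  exists2 e, 0 < e & forall i, i \in s -> P i e.
Proof.
move=> sP; suff [e e0 eP] : exists2 e, 0 < e &
    forall d i, 0 < d -> d <= e -> i \in s -> P i d.
  by exists e => // i; exact: eP.
elim: s sP => [_|a s IH sP]; first by exists 1.
have [i si|e e0 eP] := IH; first by apply: sP; rewrite inE si orbT.
have [e' e'0 e'P] := sP a (mem_head _ _).
exists (Num.min e e') => [|d i d0]; first by rewrite lt_min e0.
rewrite le_min inE => /andP[de de'] /predU1P[->|si]; [exact: e'P|exact: eP].
Qed.

Lemma small_perturb_gt0 (a b : R) : 0 < a ->
  exists2 e, 0 < e & forall d, 0 < d -> d <= e -> 0 < a + d * b.
Proof.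
move=> a0; have b1 : 0 < `|b| + 1 by rewrite ltr_wpDl.
(* The [+ 1] keeps the denominator positive when [b] is zero and makes the final inequality
   strict. *)
exists (a / (`|b| + 1)) => [|d d0]; first exact: divr_gt0.
rewrite ler_pdivlMr // mulrDr mulr1 => da.
have : d * - `|b| <= d * b by rewrite ler_pM2l // lerNl -normrN ler_norm.
by rewrite mulrN; lra.
Qed.

Lemma small_perturb_ge0 (a b : R) : 0 <= a -> (a = 0 -> 0 <= b) ->
  exists2 e, 0 < e & forall d, 0 < d -> d <= e -> 0 <= a + d * b.
Proof.
rewrite le0r => /orP[/eqP -> /(_ erefl) b0|a0 _].
  by exists 1 => // d d0 _; rewrite add0r mulr_ge0 // ltW.
have [e e0 eP] := small_perturb_gt0 b a0.
by exists e => // d d0 de; rewrite ltW // eP.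
Qed.

End SmallScalars.

Section Triangulation.
Variables (R : realType) (n : nat) (L W : 'cV[R]_n).
Local Notation E := 'rV[R]_n.
Variables (Bs : seq 'M[R]_n) (sigma : set E).

(* The linear piece, on the cone of [B], of the convex function with value
   [W i] at the i-th row of every matrix of [Bs]. *)
Definition height (B : 'M[R]_n) : 'cV[R]_n := invmx B *m W.

Hypothesis Bs_basis : forall B, B \in Bs -> slice_basis L B.
(** Strict convexity across simplices. Weights depend only on the row index, so vertices are
    compared index by index; for flags the index is the dimension of the face minus one. *)
Hypothesis Bs_regular : forall B B', B \in Bs -> B' \in Bs ->
  forall i, row i B' != row i B -> pairing (height B) (row i B') < W i 0.
Hypothesis sigma0 : sigma 0.
Hypothesis sigmaD : forall x y, sigma x -> sigma y -> sigma (x + y).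
Hypothesis sigmaZ : forall (c : R) x, 0 <= c -> sigma x -> sigma (c *: x).
Hypothesis sigma_row : forall B i, B \in Bs -> sigma (row i B).
Hypothesis sigma_cover : forall x, sigma x -> exists2 B, B \in Bs & nonneg_on B x.

Implicit Types (B : 'M[R]_n) (x y q : E) (I J : {set 'I_n}).

Lemma height_row B i : B \in Bs -> pairing (height B) (row i B) = W i 0.
Proof.
move=> /Bs_basis[Bu _].
by rewrite /pairing /height mulmxA -row_mul mulmxV // row1 -rowE mxE.
Qed.

Lemma height_row_le B B' i : B \in Bs -> B' \in Bs ->
  pairing (height B) (row i B') <= W i 0.
Proof.
move=> sB sB'; have [->|/(Bs_regular sB sB')/ltW //] := eqVneq (row i B') (row i B).
by rewrite height_row.
Qed.

Lemma heightB B B' x : B \in Bs -> B' \in Bs ->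
  pairing (height B') x - pairing (height B) x =
  \sum_i coords B' x 0 i * (W i 0 - pairing (height B) (row i B')).
Proof.
move=> sB sB'; rewrite !(pairing_coords (Bs_basis sB')) -sumrB.
by apply: eq_bigr => i _; rewrite height_row // mulrBr.
Qed.

(** The convex function is the maximum of its linear pieces: in [heightB] every term is nonnegative
    on the cone of [B']. *)
Lemma height_le B B' x : B \in Bs -> B' \in Bs -> nonneg_on B' x ->
  pairing (height B) x <= pairing (height B') x.
Proof.
move=> sB sB' x0; rewrite -subr_ge0 heightB // sumr_ge0 // => i _.
by rewrite mulr_ge0 // subr_ge0 height_row_le.
Qed.

Lemma height_eq_coords0 B B' x i : B \in Bs -> B' \in Bs -> nonneg_on B' x ->
  pairing (height B) x = pairing (height B') x ->
  row i B' != row i B -> coords B' x 0 i = 0.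
Proof.
move=> sB sB' x0 /esym/eqP; rewrite -subr_eq0 heightB // psumr_eq0 => [|j _].
  move=> /allP/(_ i (mem_index_enum i)) /=; rewrite mulf_eq0 => /orP[/eqP //|].
  by move=> + /(Bs_regular sB sB') => /eqP/subr0_eq ->; rewrite ltxx.
by rewrite mulr_ge0 // subr_ge0 height_row_le.
Qed.

(** Equality of heights leaves only the rows common to [B] and [B'], so the expansion of [x] in [B']
    is already one in [B]. *)
Lemma height_eq_coords B B' x : B \in Bs -> B' \in Bs -> nonneg_on B' x ->
  pairing (height B) x = pairing (height B') x -> coords B x = coords B' x.
Proof.
move=> sB sB' x0 hx; apply: (coords_uniq (Bs_basis sB)).
rewrite mulmx_sum_row {1}(coordsE (Bs_basis sB') x); apply: eq_bigr => i _.
have [->//|ne] := eqVneq (row i B') (row i B).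
by rewrite (height_eq_coords0 sB sB' x0 hx ne) !scale0r.
Qed.

Lemma height_eq B B' x : B \in Bs -> B' \in Bs -> nonneg_on B x ->
  nonneg_on B' x -> pairing (height B) x = pairing (height B') x.
Proof. by move=> sB sB' x0 x0'; apply: le_anti; rewrite !height_le. Qed.

Lemma splx_eq_rows B B' J : B \in Bs -> B' \in Bs ->
  (forall i, i \in J -> row i B = row i B') -> splx L B J = splx L B' J.
Proof.
have sub B1 B2 : B1 \in Bs -> B2 \in Bs ->
    (forall i, i \in J -> row i B1 = row i B2) -> splx L B1 J `<=` splx L B2 J.
  move=> s1 s2 eqr x [Lx x0 xJ].
  suff cE : coords B2 x = coords B1 x
    by split=> // i; rewrite ?cE; [exact: x0|exact: xJ].
  apply: (coords_uniq (Bs_basis s2)).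
  rewrite mulmx_sum_row {1}(coordsE (Bs_basis s1) x); apply: eq_bigr => i _.
  by have [/eqr ->|/xJ ->] := boolP (i \in J); rewrite ?scale0r.
by move=> sB sB' eqr; apply/seteqP; split; apply: sub => // i /eqr.
Qed.

(** At a common point each height is at most the other, so both coordinate vectors agree and are
    supported on the shared rows. *)
Lemma splx_meet B B' I I' : B \in Bs -> B' \in Bs ->
  splx L B I `&` splx L B' I' =
  splx L B [set i in I :&: I' | row i B' == row i B].
Proof.
move=> sB sB'; set J := [set i in _ | _].
have JE : splx L B J = splx L B' J.
  by apply: splx_eq_rows => // i; rewrite inE => /andP[_ /eqP].
apply/seteqP; split=> x.
  move=> [[Lx x0 xI] [_ x0' xI']]; have hx := height_eq sB sB' x0 x0'.
  have cE := height_eq_coords sB sB' x0' hx.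
  split=> // i; rewrite !inE !negb_and -orbA => /or3P[|iI'|ne]; first exact: xI.
    by rewrite cE xI'.
  by rewrite cE (height_eq_coords0 sB sB' x0' hx).
move=> xJ; split; first apply: (splxS _ xJ);
  last (move: xJ; rewrite JE; apply: splxS);
  by apply/fintype.subsetP => i; rewrite !inE => /andP[/andP[]].
Qed.

Definition triangulation : set (set E) :=
  [set F | exists B J, B \in Bs /\ F = splx L B J].

Lemma triangulation_subset B B' I : B \in Bs -> B' \in Bs ->
  splx L B finset.setT `<=` splx L B' I -> B = B' /\ I = finset.setT.
Proof.
move=> sB sB' sub.
have : splx L B finset.setT =
    splx L B [set i in finset.setT :&: I | row i B' == row i B].
  by rewrite -splx_meet // setIidl.
move/(splx_inj (Bs_basis sB))/finset.setP => JT.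
have {}JT i : (i \in I) && (row i B' == row i B).
  by have := JT i; rewrite !inE.
split; first by apply/row_matrixP => i; have /andP[_ /eqP] := JT i.
by apply/finset.setP => i; rewrite inE; have /andP[] := JT i.
Qed.

Lemma facet_triangulation F :
  facet triangulation F <-> exists2 B, B \in Bs & F = splx L B finset.setT.
Proof.
split=> [[[B [J [sB ->]]] Fmax]|[B sB ->]].
  exists B => //; apply/esym/Fmax; first by exists B, finset.setT.
  by apply: splxS; exact: finset.subsetT.
split=> [|_ [B' [J [sB' ->]]] sub]; first by exists B, finset.setT.
by have [-> ->] := triangulation_subset sB sB' sub.
Qed.

Lemma triangulation_simplicial : simplicial triangulation.
Proof. by move=> _ [B [J [sB ->]]]; apply: splx_simplex; exact: Bs_basis. Qed.

Lemma triangulation_complex : polytopal_complex triangulation.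
Proof.
split.
- apply/finite_seqP.
  exists [seq splx L B J | B <- Bs, J <- enum {: {set 'I_n}}].
  apply/seteqP; split=> [_ [B [J [sB ->]]]|_ /= /allpairsP[[B J] /= [sB _ ->]]].
    by apply: (allpairs_f (splx L)); rewrite ?mem_enum.
  by exists B, J.
- have [B sB _] := sigma_cover sigma0.
  by exists (splx L B finset.set0), B, finset.set0.
- by move=> _ [B [J [sB ->]]]; apply: splx_polytope; exact: Bs_basis.
- move=> _ G [B [J [sB ->]]] /(polytope_face_splx (Bs_basis sB))[J' _ ->].
  by exists B, J'.
- have face B B' J J' : B \in Bs -> B' \in Bs ->
      polytope_face (splx L B J) (splx L B J `&` splx L B' J').
    move=> sB sB'; rewrite splx_meet //.
    apply/(polytope_face_splx (Bs_basis sB)); eexists; last by [].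
    by apply/fintype.subsetP => i; rewrite !inE => /andP[/andP[]].
  move=> _ _ [B [J [sB ->]]] [B' [J' [sB' ->]]]; split; first exact: face.
  by rewrite setIC; exact: face.
Qed.

(** Differences of vertices span the kernel of [L], whichever [B] is taken; purity follows. *)
Lemma aff_dim_splx B : B \in Bs ->
  aff_dim (splx L B finset.setT) = lin_dim [set x | pairing L x = 0].
Proof.
move=> sB; rewrite /aff_dim /lin_dim; congr (\dim _); apply/eqP.
rewrite eqEsubv; apply/andP; split; apply/lin_spanP => x.
  move=> [y [z [[Ly _ _] [Lz _ _] ->]]]; apply: mem_lin_span.
  by rewrite /= pairingB Ly Lz subrr.
move=> /= Lx; have xE := coordsE (Bs_basis sB) x.
case: (pickP (fun i : 'I_n => true)) => [i0 _|no]; last first.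
  by rewrite xE big1 ?mem0v // => i; have := no i.
have -> : x = \sum_i coords B x 0 i *: (row i B - row i0 B).
  under eq_bigr do rewrite scalerBr.
  by rewrite sumrB -xE -scaler_suml (sum_coords (Bs_basis sB)) Lx scale0r subr0.
apply: memv_suml => i _; apply/memvZ/mem_lin_span.
by exists (row i B), (row i0 B); split=> //;
  apply: (splx_row (Bs_basis sB)); rewrite inE.
Qed.

Lemma triangulation_pure : pure_complex triangulation.
Proof.
move=> F G /facet_triangulation[B sB ->] /facet_triangulation[B' sB' ->].
by rewrite !aff_dim_splx.
Qed.

(* For [d] small, [y + d q] lies in [sigma]; it is then covered by a simplex
   through [y] on which the height of [q] is larger. *)
Lemma visible_facet_covered B q y i : B \in Bs -> sigma q ->
  nonneg_on B y -> coords B y 0 i = 0 -> coords B q 0 i < 0 ->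
  exists B', [/\ B' \in Bs, nonneg_on B' y &
                 pairing (height B) q < pairing (height B') q].
Proof.
move=> sB sq y0 yi qi.
(* A closed cone missing [y] still misses [y + d *: q] for small [d], so any cone that covers the
   latter contains [y]. *)
have [d d0 dP] : exists2 d : R, 0 < d & forall B', B' \in Bs ->
    nonneg_on B' (y + d *: q) -> nonneg_on B' y.
  apply: common_small => B' sB'.
  have [y0'|] := pselect (nonneg_on B' y); first by exists 1.
  move=> /existsNP[j /negP]; rewrite -ltNge => yj.
  have [|e e0 eP] := @small_perturb_gt0 _ (- coords B' y 0 j) (- coords B' q 0 j).
    by rewrite oppr_gt0.
  exists e => // d d0 de /(_ j); rewrite coordsD coordsZ => /le_gtF/negbT.
  by have := eP d d0 de; rewrite mulrN -opprD oppr_gt0 => ->.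
have sy : sigma y.
  rewrite (coordsE (Bs_basis sB) y); elim/big_ind : _ => // j _.
  by apply: sigmaZ => //; exact: sigma_row.
have [|B' sB' z0] := @sigma_cover (y + d *: q).
  by apply: sigmaD => //; apply: sigmaZ => //; exact: ltW.
have y0' := dP _ sB' z0; exists B'; split=> //.
(* Equal heights at [y + d *: q] would make its coordinates in [B] nonnegative, but the one at [i]
   is [d] times a negative number. *)
have := height_le sB sB' z0; rewrite le_eqVlt => /orP[/eqP hz|].
  have := z0 i; rewrite -(height_eq_coords sB sB' z0 hz) coordsD coordsZ yi add0r.
  by rewrite pmulr_rge0 // leNgt qi.
by rewrite !pairingD !pairingZ (height_eq sB sB' y0 y0') ltrD2l ltr_pM2l.
Qed.

Lemma earlier_meets_visible B B' q y : B \in Bs -> B' \in Bs ->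
  nonneg_on B y -> nonneg_on B' y ->
  pairing (height B) q < pairing (height B') q ->
  exists2 i, coords B y 0 i = 0 & coords B q 0 i < 0.
Proof.
move=> sB sB' y0 y0' hq; apply: contrapT => novis.
have [d d0 dP] : exists2 d : R, 0 < d & forall i, i \in enum 'I_n ->
    0 <= coords B y 0 i + d * coords B q 0 i.
  apply: common_small => i _; apply: small_perturb_ge0 => // yi.
  by rewrite leNgt; apply: contra_notN novis => qi; exists i.
have : nonneg_on B (y + d *: q).
  by move=> i; rewrite coordsD coordsZ dP ?mem_enum.
move=> /(height_le sB' sB); rewrite !pairingD !pairingZ.
by rewrite (height_eq sB sB' y0 y0') lerD2l ler_pM2l // leNgt hq.
Qed.

(** If the point found so far is a zero of [g], a small move towards a [u] with nonzero [g] leaves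
    that hyperplane and keeps off the others. *)
Lemma generic_point (gs : seq 'cV[R]_n) :
  (forall g, g \in gs -> exists2 u, sigma u & pairing g u != 0) ->
  exists2 q, sigma q & forall g, g \in gs -> pairing g q != 0.
Proof.
elim: gs => [_|g gs IH gsP]; first by exists 0.
have [h hs|q sq qP] := IH; first by apply: gsP; rewrite inE hs orbT.
have [gq|gq] := eqVneq (pairing g q) 0; last first.
  by exists q => // h; rewrite inE => /predU1P[->|/qP].
have [u su gu] := gsP g (mem_head _ _).
have [d d0 dP] : exists2 d : R, 0 < d & forall h, h \in gs ->
    pairing h (q + d *: u) != 0.
  apply: common_small => h /qP hq.
  have [|e e0 eP] := @small_perturb_gt0 _ (`|pairing h q|) (- `|pairing h u|).
    by rewrite normr_gt0.
  exists e => // d d0 de; rewrite pairingD pairingZ.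
  have := eP d d0 de; rewrite mulrN subr_gt0 => lt.
  rewrite addr_eq0; apply: contraTneq lt => ->.
  by rewrite normrN normrM gtr0_norm // ltxx.
exists (q + d *: u) => [|h].
  by apply: sigmaD => //; apply: sigmaZ => //; exact: ltW.
rewrite inE => /predU1P[->|/dP //].
by rewrite pairingD pairingZ gq add0r mulf_neq0 // gt_eqF.
Qed.

(** Distinct matrices differ in some row, where regularity separates their heights; so no difference
    of heights vanishes on all of [sigma], and a generic point applies. *)
Lemma height_separated :
  exists2 q, sigma q & forall B B', B \in Bs -> B' \in Bs ->
    pairing (height B) q = pairing (height B') q -> B = B'.
Proof.
pose gs := [seq height BB.1 - height BB.2 |
              BB <- [seq (B, B') | B <- Bs, B' <- Bs] & BB.1 != BB.2].
have [g|q sq qP] := @generic_point gs.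
  move=> /mapP[[B B']]; rewrite mem_filter => /andP[/= ne].
  move=> /allpairsP[[C C'] /= [sC sC' [EC EC']]] ->; move: sC sC' ne.
  rewrite -EC -EC' => sB sB' ne.
  have [i nei] : exists i, row i B' != row i B.
    apply: contrapT => /forallNP eqr; move/eqP: ne; apply.
    by apply/row_matrixP => i; apply/esym/eqP/negPn/negP.
  exists (row i B'); first exact: sigma_row.
  by rewrite pairingDl pairingNl (height_row i sB') lt_eqF // subr_lt0 Bs_regular.
exists q => // B B' sB sB' hq; apply/eqP/negPn/negP => ne.
have : height B - height B' \in gs.
  apply/mapP; exists (B, B') => //; rewrite mem_filter /= ne /=.
  by apply: (allpairs_f (fun B B' => (B, B'))).
by move=> /qP; rewrite pairingDl pairingNl hq subrr eqxx.
Qed.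

Theorem triangulation_shellable : uniq Bs -> shellable triangulation.
Proof.
move=> uBs; split; [exact: triangulation_complex|exact: triangulation_pure|].
have [q sq q_inj] := height_separated.
pose r B B' := pairing (height B') q <= pairing (height B) q.
have r_tot : total r by move=> B B'; exact: le_total.
have r_tr : transitive r by move=> B2 B1 B3 h12 h23; exact: le_trans h23 h12.
have := sort_sorted r_tot Bs; have := mem_sort r Bs; have := sort_uniq r Bs.
rewrite uBs; case: (sort r Bs) => [|B1 s] us ms; move: (ms).
  have [B sB _] := sigma_cover sigma0.
  by move/(_ B); rewrite sB in_nil.
rewrite sorted_pairwise // => _ ps.
pose F B := splx L B finset.setT.
exists (map F (B1 :: s)) => /=; apply: ShellingStep.
- rewrite -[_ :: _]/(map F (B1 :: s)); split=> [|G].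
    rewrite map_inj_in_uniq // => B B'; rewrite !ms => sB sB' FE.
    by have [] := @triangulation_subset B B' finset.setT sB sB';
      rewrite // -/(F B) FE.
  split=> [/mapP[B]|/facet_triangulation[B sB ->]].
    by rewrite ms => sB ->; apply/facet_triangulation; exists B.
  by apply: (map_f F); rewrite ms.
- have sB1 : B1 \in Bs by rewrite -ms mem_head.
  exists [seq splx L B1 (finset.setT :\ i) | i <- enum 'I_n].
  apply: (shelling_boundary_splx (Bs_basis sB1)); first exact: enum_uniq.
  by move=> i; rewrite mem_enum !inE.
move=> s1 G s2 sE; have [r1 [B [r2 [rE -> -> _]]]] := map_cat_cons sE.
have sB : B \in Bs by rewrite -ms rE inE mem_cat mem_head !orbT.
(* Injectivity of the heights at [q] turns position in the sorted list into a strict inequality. *)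
have earlierP B' : B' \in B1 :: r1 <->
    B' \in Bs /\ pairing (height B) q < pairing (height B') q.
  move: ps us ms; rewrite rE -cat_cons => ps us ms; move: ps us.
  rewrite pairwise_cat cat_uniq => /and3P[/allrelP rr1 _ /= /andP[/allP rr2 _]].
  move=> /and3P[_ /= dis _]; split=> [B'r|].
    have sB' : B' \in Bs by rewrite -ms mem_cat B'r.
    split=> //; rewrite lt_neqAle [_ <= _](rr1 B' B) ?mem_head // andbT.
    apply: contraNneq dis => /(q_inj _ _ sB sB') ->.
    by rewrite B'r.
  rewrite -ms mem_cat inE => -[/or3P[//|/eqP ->|/rr2 h]]; first by rewrite ltxx.
  by rewrite ltNge (h : _ <= _).
pose vis i := coords B q 0 i < 0.
pose Fi i := splx L B (finset.setT :\ i).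
(* Listing the visible facets first makes them an initial segment of a shelling of the boundary. *)
exists [seq Fi i | i <- enum 'I_n & vis i], [seq Fi i | i <- enum 'I_n & ~~ vis i].
split.
- have /earlierP[sB1 hB1] := mem_head B1 r1.
  (* With no visible facet, [q] would lie in the cone of [B], where no earlier height can be
     larger. *)
  have [i vi] : exists i, vis i.
    apply: contrapT => /forallNP novis; move: hB1; rewrite ltNge height_le //.
    by move=> i; rewrite leNgt; apply/negP/novis.
  have : i \in [seq i <- enum 'I_n | vis i] by rewrite mem_filter vi mem_enum.
  by case: [seq i <- _ | _].
- rewrite -map_cat; apply: (shelling_boundary_splx (Bs_basis sB)).
    by rewrite (perm_uniq (permEl (perm_filterC _ _))) enum_uniq.
  by move=> i; rewrite (perm_mem (permEl (perm_filterC _ _))) mem_enum !inE.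
rewrite -[_ :: _]/(map F (B1 :: r1)).
apply/seteqP; split=> y.
  move=> [[Ly y0 yT] /union_seqP[_ /mapP[B' /earlierP[sB' hB'] ->] [_ y0' _]]].
  have [i yi qi] := earlier_meets_visible sB sB' y0 y0' hB'.
  apply/union_seqP; exists (Fi i).
    by apply: (map_f Fi); rewrite mem_filter mem_enum andbT.
  by split=> // j; rewrite !inE andbT negbK => /eqP ->.
move=> /union_seqP[_ /mapP[i + ->] [Ly y0 yi]]; rewrite mem_filter => /andP[qi _].
have {}yi : coords B y 0 i = 0 by apply: yi; rewrite !inE eqxx.
split; first by split=> // j; rewrite inE.
have [B' [sB' y0' hB']] := visible_facet_covered sB sq y0 yi qi.
apply/union_seqP; exists (F B'); first exact/(map_f F)/earlierP.
by split=> // j; rewrite inE.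
Qed.

End Triangulation.

(** * Full flags of faces *)

(** For small [d] the term of index [k] dominates: all terms of smaller index, and [d ^+ (n - i)]
    too, carry at least one more factor [d]. *)
Lemma leading_coefficient_dominates (R : realType) (n : nat) (c : 'I_n -> R)
    (i k : 'I_n) : 0 < c k -> (i < k)%N ->
  (forall j : 'I_n, (k < j)%N -> c j = 0) ->
  exists2 e, 0 < e & forall d, 0 < d -> d <= e ->
    \sum_j c j * - d ^+ (n - j) < - d ^+ (n - i).
Proof.
move=> ck ik c0; pose K := \sum_j `|c j|.
(* After division by [d ^+ (n - k)], [K] accounts for the other terms of the sum and [1] for the
   right-hand side. *)
have [e e0 eP] := small_perturb_gt0 (- (1 + K)) ck.
exists (Num.min e 1) => [|d d0]; first by rewrite lt_min e0 ltr01.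
rewrite le_min => /andP[de d1].
have pow (j : 'I_n) : (j < k)%N -> d ^+ (n - j) <= d * d ^+ (n - k).
  by move=> jk; rewrite -exprS ler_wiXn2l ?(ltW d0) //; have := ltn_ord k; lia.
have dk0 : 0 < d ^+ (n - k) by rewrite exprn_gt0.
apply: (@le_lt_trans _ _ (- (c k * d ^+ (n - k)) + K * (d * d ^+ (n - k)))).
  rewrite (bigD1 k) //= mulrN lerD2l.
  have -> : K = `|c k| + \sum_(j | j != k) `|c j| by rewrite /K (bigD1 k).
  rewrite mulrDl ler_wpDl ?mulr_ge0 ?(ltW d0) ?(ltW dk0) // mulr_suml.
  apply: ler_sum => j jk; have [kj|jk'] := ltnP k j.
    by rewrite (c0 j kj) normr0 !mul0r.
  rewrite mulrN (le_trans (ler_norm _)) // normrN normrM.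
  rewrite ler_wpM2l // ger0_norm ?exprn_ge0 ?(ltW d0) // pow //.
  by rewrite ltn_neqAle jk' andbT.
rewrite addrC -subr_gt0; have := eP d d0 de; have := pow i ik.
move: (d ^+ (n - i)) (d ^+ (n - k)) dk0 => u v v0 uv h.
have : 0 < (c k + d * - (1 + K)) * v by rewrite mulr_gt0.
by rewrite mulrDl mulrN mulrDr mulr1 mulNr mulrDl; lra.
Qed.

Section Flags.
Variables (R : realType) (n : nat) (L : 'cV[R]_n).
Local Notation E := 'rV[R]_n.
Variables (s : seq E) (p : set E -> E).
Local Notation sigma := (cone_hull [set` s]).

Hypothesis L_ge0 : forall x, sigma x -> 0 <= pairing L x.
Hypothesis p_slice : forall mu, cone_face sigma mu -> mu <> [set 0] ->
  pairing L (p mu) = 1.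
Hypothesis p_in : forall mu, cone_face sigma mu -> mu <> [set 0] -> mu (p mu).
Hypothesis p_interior : forall mu f, cone_face sigma mu -> mu <> [set 0] ->
  (forall y, mu y -> 0 <= pairing f y) -> pairing f (p mu) = 0 ->
  forall y, mu y -> pairing f y = 0.
Hypothesis sigma_dim : lin_dim sigma = n.

Implicit Types (mu nu : 'I_n -> set E) (f : 'cV[R]_n) (x z : E).

Definition flag_matrix mu : 'M[R]_n := \matrix_i p (mu i).

Lemma dim_gt0_neq0 (tau : set E) : (0 < lin_dim tau)%N -> tau <> [set 0].
Proof. by move=> + tau0; rewrite tau0 lin_dim_set0. Qed.

Lemma flag_neq0 mu i : full_flag sigma mu -> mu i <> [set 0].
Proof. by move=> [_ _ mudim _]; apply: dim_gt0_neq0; rewrite mudim. Qed.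

Lemma flag_in_sigma mu i x : full_flag sigma mu -> mu i x -> sigma x.
Proof. by move=> [muF _ _ _]; exact: cone_face_sub. Qed.

(** Take the form cutting out the preceding face of the flag, or [L] when there is none. If it
    vanished at the interior point of [mu k], it would vanish on [mu k], contradicting
    dimensions. *)
Lemma flag_form mu (k : 'I_n) : full_flag sigma mu ->
  exists f, [/\ forall x, sigma x -> 0 <= pairing f x,
    forall i : 'I_n, (i < k)%N -> pairing f (p (mu i)) = 0 &
    0 < pairing f (p (mu k))].
Proof.
move=> muP; have [muF mu_le mudim _] := muP.
have mup i := p_in (muF i) (@flag_neq0 mu i muP).
case: k => -[|k] kn.
  by exists L; split=> //; rewrite p_slice ?ltr01 //; exact: flag_neq0.
pose k' := Ordinal (ltnW kn); have [f [f0 muE]] := muF k'.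
exists f; split=> // [i ik|].
  by have : mu k' (p (mu i)); [exact: (mu_le i k')|rewrite muE => -[]].
rewrite lt_neqAle f0 ?andbT; last exact: flag_in_sigma muP (mup _).
apply/eqP => /esym fk.
have fmu := p_interior (muF _) (flag_neq0 muP)
  (fun y muy => f0 y (flag_in_sigma muP muy)) fk.
have : mu (Ordinal kn) `<=` mu k'.
  by move=> y muy; rewrite muE; split; [exact: flag_in_sigma muP muy|exact: fmu].
move/lin_spanS/dimvS; rewrite -/(lin_dim _) -/(lin_dim (mu k')) !mudim /=.
by rewrite ltnn.
Qed.

(** Paired with the forms of [flag_form], the points give a triangular matrix with positive
    diagonal. *)
Lemma flag_basis mu : full_flag sigma mu -> slice_basis L (flag_matrix mu).
Proof.
move=> muP; split; last first.
  apply/row_matrixP => i; rewrite row_mul rowK; apply/rowP => j.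
  have [muF _ _ _] := muP; rewrite ord1 [RHS]mxE [RHS]mxE.
  exact: p_slice (muF i) (flag_neq0 muP).
have /choice[f fP] := fun k => flag_form k muP.
pose F : 'M[R]_n := \matrix_(j, k) f k j 0.
have BF i k : (flag_matrix mu *m F) i k = pairing (f k) (p (mu i)).
  by rewrite /pairing !mxE; apply: eq_bigr => j _; rewrite !mxE.
have : flag_matrix mu *m F \in unitmx.
  rewrite unitmxE unitfE det_trig; last first.
    by apply/is_trig_mxP => i k ik; rewrite BF; have [_ + _] := fP k; exact.
  by apply/prodf_neq0 => k _; rewrite BF gt_eqF //; have [] := fP k.
by rewrite unitmx_mul => /andP[].
Qed.

Definition flag_weight (e : R) : 'cV[R]_n := \col_i - e ^+ (n - i).

(* Let [k] be the last index with a nonzero coordinate of [p (nu i)] with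
   respect to [mu].  The form of [flag_form] at [k] shows that this coordinate
   is positive, and [k <= i] would force [nu i = mu i]. *)
Lemma flag_regular mu nu i : full_flag sigma mu -> full_flag sigma nu ->
  p (nu i) != p (mu i) ->
  exists2 e, 0 < e & forall d, 0 < d -> d <= e ->
    pairing (height (flag_weight d) (flag_matrix mu)) (p (nu i)) <
    flag_weight d i 0.
Proof.
move=> muP nuP ne; have B := flag_basis muP.
have [muF mu_le mudim _] := muP; have [nuF _ nudim _] := nuP.
set c := fun j => coords (flag_matrix mu) (p (nu i)) 0 j.
have cE f : pairing f (p (nu i)) = \sum_j c j * pairing f (p (mu j)).
  by rewrite (pairing_coords B); apply: eq_bigr => j _; rewrite rowK.
have nup := p_in (nuF i) (@flag_neq0 nu i nuP).
have [k0 ck0] : exists j, c j != 0.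
  apply: contrapT => /forallNP c0; have := cE L.
  rewrite (p_slice (nuF i) (flag_neq0 nuP)) big1 => [/eqP|j _].
    by rewrite oner_eq0.
  by have /negP/negPn/eqP -> := c0 j; rewrite mul0r.
have [k ck kmax] := @arg_maxnP _ k0 (fun j => c j != 0) (@nat_of_ord n) ck0.
have c0 (j : 'I_n) : (k < j)%N -> c j = 0.
  by move=> kj; apply/eqP/negPn/negP => /kmax /=; rewrite leqNgt kj.
have ckpos : 0 < c k.
  have [f [f0 fk fkk]] := flag_form k muP.
  have := f0 _ (flag_in_sigma nuP nup).
  rewrite cE (bigD1 k) //= big1 ?addr0 => [|j jk].
    by rewrite pmulr_lge0 // lt_neqAle eq_sym ck.
  have [kj|jk'] := ltnP k j; first by rewrite c0 // mul0r.
  by rewrite fk ?mulr0 // ltn_neqAle jk'; rewrite andbT.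
have ik : (i < k)%N.
  rewrite ltnNge; apply: contra_neqN ne => ki; congr (p _).
  have [f [f0 muE]] := muF i.
  (* Only points of [mu i] occur in the expansion, so the form cutting out [mu i] vanishes at the
     interior point of [nu i], hence on [nu i]; equal dimensions then give equal faces. *)
  have fnu : pairing f (p (nu i)) = 0.
    rewrite cE big1 // => j _; have [kj|jk] := ltnP k j.
      by rewrite c0 // mul0r.
    have : mu i (p (mu j)).
      by apply: (mu_le j i (leq_trans jk ki)); apply: p_in => //; exact: flag_neq0.
    by rewrite muE => -[_ ->]; rewrite mulr0.
  have sub : nu i `<=` mu i.
    move=> y nuy; rewrite muE; split; first exact: flag_in_sigma nuP nuy.
    apply: (p_interior (nuF i) (flag_neq0 nuP) _ fnu nuy) => z nuz.
    exact: f0 _ (flag_in_sigma nuP nuz).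
  apply/seteqP; split=> // y muy.
  apply: (cone_face_lin_span (nuF i) (flag_in_sigma muP muy)).
  suff -> : lin_span (nu i) = lin_span (mu i) by exact: mem_lin_span.
  apply/eqP; rewrite eqEdim lin_spanS //= -/(lin_dim _) -/(lin_dim (nu i)).
  by rewrite mudim nudim.
have [e e0 eP] := leading_coefficient_dominates ckpos ik c0.
exists e => // d d0 de; rewrite [ltRHS]mxE; apply: le_lt_trans (eP d d0 de).
rewrite /pairing mulmxA mxE le_eqVlt; apply/orP; left; apply/eqP.
by apply: eq_bigr => j _; rewrite [X in _ * X]mxE.
Qed.

(** By [cone_face_gen] each face is generated by a sublist of [s], so a flag is encoded by a family
    of bit masks. *)
Lemma flag_matrices_finite : exists Bs : seq 'M[R]_n, uniq Bs /\
  forall B, B \in Bs <-> exists2 mu, full_flag sigma mu & B = flag_matrix mu.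
Proof.
pose phi (g : {ffun 'I_n -> (size s).-tuple bool}) (i : 'I_n) : set E :=
  cone_hull [set` mask (g i) s].
exists (undup [seq flag_matrix (phi g) |
  g <- enum {: {ffun 'I_n -> (size s).-tuple bool}} & `[< full_flag sigma (phi g) >]]).
split=> [|B]; first exact: undup_uniq.
rewrite mem_undup; split=> [/mapP[g]|[mu muP ->]].
  by rewrite mem_filter => /andP[/asboolP gP _] ->; exists (phi g).
have [muF _ _ _] := muP; have /choice[q qP] := fun i => cone_face_gen (muF i).
pose g := [ffun i => map_tuple (q i) (in_tuple s)].
have phig : phi g = mu.
  by apply/funext => i; rewrite /phi ffunE qP filter_mask.
apply/mapP; exists g; last by rewrite phig.
by rewrite mem_filter mem_enum andbT phig; exact/asboolP.
Qed.

(** Move from [z] against [p tau] until the first wall of [sigma] is hit; its form is positive at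
    [p tau], so [cone_facet_through] gives a facet of [tau] through the exit point. *)
Lemma exit_face (tau : set E) z : cone_face sigma tau -> tau <> [set 0] ->
  tau z -> exists (t : R) (nu : set E), [/\ 0 <= t, cone_face sigma nu, nu `<=` tau,
    lin_dim tau = (lin_dim nu).+1 & nu (z - t *: p tau)].
Proof.
move=> tauF tau0 tauz; have taup := p_in tauF tau0.
have [Bw BwP] := cone_hull_halfspaces s.
have sub := cone_face_sub tauF; have sp := sub _ taup; have sz := sub _ tauz.
have w0 f x : f \in Bw -> sigma x -> 0 <= pairing f x by move=> fB /BwP; apply.
have [f] : exists2 f, f \in [seq f <- Bw | 0 < pairing f (p tau)] &
    forall g, g \in [seq f <- Bw | 0 < pairing f (p tau)] ->
      pairing f z / pairing f (p tau) <= pairing g z / pairing g (p tau).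
  apply: (seq_argmin (fun f => pairing f z / pairing f (p tau))).
  (* If no wall stopped the motion, [- p tau] would lie in [sigma], although [L] is negative
     there. *)
  apply/eqP => nil; suff /L_ge0 : sigma (- p tau).
    by rewrite pairingN p_slice // oppr_ge0 ler10.
  apply/BwP => f fB; rewrite pairingN oppr_ge0 leNgt; apply/negP => fp.
  have : f \in [seq f <- Bw | 0 < pairing f (p tau)] by rewrite mem_filter fp.
  by rewrite nil.
rewrite mem_filter => /andP[fp fB] fmin; set t := _ / _ in fmin.
have t0 : 0 <= t by rewrite divr_ge0 ?w0.
have sz' : sigma (z - t *: p tau).
  apply/BwP => g gB; rewrite pairingB pairingZ subr_ge0.
  have := w0 g _ gB sp; rewrite le0r => /orP[/eqP ->|gp].
    by rewrite mulr0 w0.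
  by rewrite -ler_pdivlMr // fmin // mem_filter gp.
have tauz' : tau (z - t *: p tau).
  have [g [_ gE]] := tauF.
  have tauE x : tau x <-> sigma x /\ pairing g x = 0 by rewrite [in tau x]gE.
  have [/tauE[_ gp] /tauE[_ gz]] := (taup, tauz).
  by apply/tauE; split=> //; rewrite pairingB pairingZ gp gz mulr0 subr0.
have [q tauE] := cone_face_gen tauF.
have [||||nu] := @cone_facet_through _ _ [seq x <- s | q x] f (z - t *: p tau).
- by rewrite -tauE => x /sub; exact: w0.
- by rewrite -tauE.
- by rewrite pairingB pairingZ divfK ?subrr // gt_eqF.
- by rewrite -tauE; exists (p tau); rewrite // gt_eqF.
rewrite -tauE => -[nuF nuz dimE]; exists t, nu; split=> //.
- exact: cone_face_trans tauF nuF.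
- exact: cone_face_sub nuF.
Qed.

(** Iterating [exit_face] lowers the dimension by one each time and ends at the origin. Families
    over [nat], arbitrary from [d] on, let the induction append [tau] at the top. *)
Lemma face_covered_by_flags d (tau : set E) z :
  cone_face sigma tau -> lin_dim tau = d -> tau z ->
  exists (m : nat -> set E) (t : nat -> R),
    [/\ forall i, (i < d)%N -> cone_face sigma (m i) /\ lin_dim (m i) = i.+1,
        forall i j, (i <= j)%N -> (j < d)%N -> m i `<=` m j,
        forall i, (i < d)%N -> m i `<=` tau /\ (i.+1 = d -> m i = tau),
        forall i, 0 <= t i &
        z = \sum_(i < d) t i *: p (m i)].
Proof.
elim: d tau z => [|d IH] tau z tauF dimE tauz.
  exists (fun=> tau), (fun=> 0); split=> //.
  by rewrite big_ord0; exact: lin_dim0P dimE z tauz.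
have tau0 : tau <> [set 0] by apply: dim_gt0_neq0; rewrite dimE.
have [u [nu [u0 nuF nutau]]] := exit_face tauF tau0 tauz.
rewrite dimE => -[/esym dimnu] nuz.
have [m [t [mF mle mtau t0 zE]]] := IH nu _ nuF dimnu nuz.
exists (fun i => if (i < d)%N then m i else tau),
       (fun i => if (i < d)%N then t i else u); split.
- move=> i; rewrite ltnS leq_eqVlt => /predU1P[->|id]; first by rewrite ltnn.
  by rewrite id; exact: mF.
- move=> i j ij; have [jd _|dj _] := ltnP j d.
    by rewrite (leq_ltn_trans ij jd); exact: mle.
  have [id|_] := ltnP i d; last exact: subset_refl.
  have [mnu _] := mtau i id; exact: subset_trans mnu nutau.
- move=> i _; have [id|_] := ltnP i d; last by split=> //; exact: subset_refl.
  have [mnu _] := mtau i id; split; first exact: subset_trans mnu nutau.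
  by move=> [id']; rewrite id' ltnn in id.
- by move=> i; case: ifP.
rewrite big_ord_recr /= ltnn -[LHS](subrK (u *: p tau)) zE; congr (_ + _).
by apply: eq_bigr => i _; rewrite ltn_ord.
Qed.

Lemma flags_cover x : sigma x ->
  exists2 mu, full_flag sigma mu & nonneg_on (flag_matrix mu) x.
Proof.
move=> sx; have [m [t [mF mle mtau t0 xE]]] :=
  face_covered_by_flags (cone_face_refl sigma) sigma_dim sx.
have muP : full_flag sigma (fun i : 'I_n => m i).
  split=> [i|i j ij|i|i id].
  - by have [] := mF i (ltn_ord i).
  - exact: mle.
  - by have [] := mF i (ltn_ord i).
  - by have [_ ->] := mtau i (ltn_ord i).
exists (fun i => m i) => // i.
rewrite (@coords_uniq _ _ _ _ (flag_basis muP) _ (\row_j t j)) ?mxE //.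
by rewrite mulmx_sum_row xE; apply: eq_bigr => j _; rewrite mxE rowK.
Qed.

End Flags.

(** * Slices of simplicial cones *)

Section SliceFaces.
Variables (R : realType) (n : nat) (L : 'cV[R]_n) (B : 'M[R]_n).
Hypothesis HB : slice_basis L B.

Lemma cone_hull_rows : cone_hull (range (fun i => row i B)) = nonneg_on B.
Proof.
apply/seteqP; split=> x; last first.
  move=> x0; rewrite (coordsE HB x); elim/big_ind : _ => [||i _].
  - exact: cone_hull0.
  - exact: cone_hullD.
  - by apply/cone_hullZ/cone_hull_gen => //; exists i.
move: x; apply: cone_hull_min => [_ [i _ <-] j|i|x y x0 y0 i|c x c0 x0 i].
- by rewrite (coords_row HB).
- by rewrite /coords mul0mx mxE.
- by rewrite coordsD addr_ge0.
- by rewrite coordsZ mulr_ge0.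
Qed.

Lemma slice_cone_face (G : set 'rV[R]_n) :
  (exists2 tau, cone_face (nonneg_on B) tau &
     tau `&` [set x | pairing L x = 1] = G) <->
  exists J, G = splx L B J.
Proof.
split=> [[_ [f [f0 ->]] <-]|[J GJ]].
  have [J _ JE] : exists2 J : {set 'I_n}, J \subset finset.setT &
      splx L B finset.setT `&` [set x | pairing (- f) x = 0] = splx L B J.
    apply/(polytope_face_splx HB); exists (- f), 0; split=> // x [_ x0 _].
    by rewrite pairingNl oppr_le0 f0.
  exists J; rewrite -JE; apply/seteqP; split=> x.
    move=> [[x0 /= fx] Lx]; split; first by split=> // i; rewrite inE.
    by rewrite /= pairingNl fx oppr0.
  by move=> [[Lx x0 _] /= /eqP]; rewrite pairingNl oppr_eq0 => /eqP.
have [|f [c [fc ->]]] := (polytope_face_splx HB finset.setT G).2.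
  by exists J; rewrite ?finset.subsetT.
(* Homogenisation: on [L = 1] the inequality [f <= c] is nonnegativity of the linear form
   [c *: L - f]. *)
exists (nonneg_on B `&` [set x | pairing (c *: L - f) x = 0]).
  exists (c *: L - f); split=> // x x0.
  rewrite (pairing_coords HB) sumr_ge0 // => i _.
  rewrite mulr_ge0 // pairingDl pairingNl pairingZl (pairing_row HB) mulr1 subr_ge0.
  by apply: fc; apply: (splx_row HB); rewrite inE.
apply/seteqP; split=> x /=; rewrite pairingDl pairingNl pairingZl.
  move=> [[x0 fx] Lx]; split.
    by split=> // i; rewrite inE.
  by move: fx; rewrite Lx mulr1 => /subr0_eq ->.
by move=> [[Lx x0 _] fx]; rewrite Lx mulr1 fx subrr.
Qed.

End SliceFaces.

(** * Shellability of the barycentric subdivision *)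

Theorem proposition2p16 (R : realType) (n : nat) (sigma : set 'rV[R]_n)
    (l : 'cV[rat]_n) (rho : set 'rV[R]_n -> 'rV[rat]_n) :
  rational_polyhedral_cone sigma ->
  strongly_convex sigma ->
  lin_dim sigma = n ->
  barycentric_choice sigma l rho ->
  simplicial (slice_complex l (barycentric_fan sigma rho)) /\
  shellable (slice_complex l (barycentric_fan sigma rho)).
Proof.
move=> [A Afin sigmaE] _ + [+ _ rhoP].
have /finite_seqP[s sE] : finite_set (@latt R n @` A) by exact: finite_image.
rewrite {}sE in sigmaE; rewrite {}sigmaE in rhoP *.
move: rhoP; set sigma0 := cone_hull _ => rhoP dimE l_ge0.
pose p mu := ratv R (rho mu); pose L := ratf R l.
have p_slice mu : cone_face sigma0 mu -> mu <> [set 0] -> pairing L (p mu) = 1.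
  by move=> muF mu0; have [[]] := rhoP mu muF mu0.
have p_in mu : cone_face sigma0 mu -> mu <> [set 0] -> mu (p mu).
  by move=> muF mu0; have [_ /interior_subset] := rhoP mu muF mu0.
have p_interior mu f : cone_face sigma0 mu -> mu <> [set 0] ->
    (forall y, mu y -> 0 <= pairing f y) -> pairing f (p mu) = 0 ->
    forall y, mu y -> pairing f y = 0.
  move=> muF mu0; have [_] := rhoP mu muF mu0; exact: relint_form0.
have [Bs [uBs BsP]] := flag_matrices_finite s p.
have basis B : B \in Bs -> slice_basis L B.
  by move=> /BsP[mu muP ->]; exact: (flag_basis l_ge0 p_slice p_in p_interior muP).
(* There are finitely many pairs of flag matrices and rows, so a single [e] makes all the regularity
   inequalities hold. *)
have [e e0 eP] : exists2 e : R, 0 < e &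
    forall t, t \in [seq (BB, i) | BB <- [seq (B, B') | B <- Bs, B' <- Bs],
                                   i <- enum 'I_n] ->
      row t.2 t.1.2 != row t.2 t.1.1 ->
      pairing (height (flag_weight n e) t.1.1) (row t.2 t.1.2) <
        flag_weight n e t.2 0.
  apply: common_small => t /allpairsP[[BB i] /= [+ _ ->]].
  move=> /allpairsP[[B B'] /= [/BsP[mu muP ->] /BsP[nu nuP ->] ->]] /=.
  rewrite !rowK; have [->|ne] := eqVneq (p (nu i)) (p (mu i)).
    by exists 1.
  have [d d0 dP] := flag_regular l_ge0 p_slice p_in p_interior muP nuP ne.
  by exists d => // d' d'0 d'd _; exact: dP.
have regular B B' : B \in Bs -> B' \in Bs -> forall i, row i B' != row i B ->
    pairing (height (flag_weight n e) B) (row i B') < flag_weight n e i 0.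
  move=> sB sB' i; apply: (eP (B, B', i)).
  apply: (allpairs_f (fun BB i => (BB, i))); last by rewrite mem_enum.
  exact: (allpairs_f (fun B B' => (B, B'))).
have cover x : sigma0 x -> exists2 B, B \in Bs & nonneg_on B x.
  move=> sx; have [mu muP x0] := flags_cover l_ge0 p_slice p_in p_interior dimE sx.
  by exists (flag_matrix p mu) => //; apply/BsP; exists mu.
have sigma_row B i : B \in Bs -> sigma0 (row i B).
  move=> /BsP[mu muP ->]; rewrite rowK.
  have [muF _ _ _] := muP.
  exact: cone_face_sub (muF i) _ (p_in _ (muF i) (flag_neq0 muP)).
have -> : slice_complex l (barycentric_fan sigma0 rho) = triangulation L Bs.
  have rows mu : range (fun i => p (mu i)) =
      range (fun i => row i (flag_matrix p mu)).
    by apply: eq_imagel => i _; rewrite rowK.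
  apply/seteqP; split=> [_ [tau [mu [muP tauF]] <-]|_ [B [J [sB ->]]]].
    have sB : flag_matrix p mu \in Bs by apply/BsP; exists mu.
    move: tauF; rewrite rows (cone_hull_rows (basis _ sB)) => tauF.
    have [J JE] := (slice_cone_face (basis _ sB) _).1 (ex_intro2 _ _ tau tauF erefl).
    by exists (flag_matrix p mu), J; split=> //; rewrite -JE.
  have [mu muP BE] := (BsP B).1 sB.
  have [tau tauF <-] := (slice_cone_face (basis _ sB) _).2 (ex_intro _ J erefl).
  exists tau => //; exists mu; split=> //.
  by rewrite rows -BE (cone_hull_rows (basis _ sB)).
split; first exact: triangulation_simplicial basis.
apply: (triangulation_shellable basis regular _ _ _ sigma_row cover uBs).
- exact: cone_hull0.
- exact: cone_hullD.
- by move=> c x; exact: cone_hullZ.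
Qed.
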